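(* Let $h\ge0$ be a half-integer, $\sigma\in\{-,+\}^3$, $R^+=\mathbb C[k_1,k_2,k_3]/I^+$, $X^+=V(I^+)$, $M=M_h^{+,\sigma}$, and $Z_3=\{k_1=0\}\cup\{k_2=0\}\cup\{k_3=0\}\subset X^+$. Then restriction induces an injection of graded $R^+$-modules $M\hookrightarrow\widetilde M(X^+-Z_3)$. The module $M$ is generated in degree $6h$. The module $\widetilde M(X^+-Z_3)$ is generated in degree $6h$ if $\sigma=(+,+,+)$ or $(-,-,-)$, and in degree $4h$ if $\sigma$ is a permutation of $(+,+,-)$ or of $(+,-,-)$. As a representation of the Lorentz group, its degree $4h$ subspace is isomorphic to $S^{2h}(\mathbf{(0,\tfrac12)}\oplus\mathbf{(0,\tfrac12)})$ if $\sigma$ is a permutation of $(+,+,-)$ and to $S^{2h}\mathbf{(\tfrac12,0)}$ if $\sigma$ is a permutation of $(+,-,-)$.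
   Context: $k_i=\begin{pmatrix}a_i&b_i\\c_i&d_i\end{pmatrix}$; $I^+\subset\mathbb C[k_1,k_2,k_3]$ is the prime ideal generated by the four entries of $k_1+k_2+k_3$ and all maximal ($2\times2$) minors of the $2\times6$ matrix $(k_1\,k_2\,k_3)$. For $k$ with $ad=bc$, $S^{2h}k^+$ is the $(2h+1)\times(2h+1)$ matrix with $(i,j)$ entry $a^{2h-i-j}b^jc^i$ if $i+j\le2h$ and $b^{2h-i}c^{2h-j}d^{i+j-2h}$ if $i+j\ge2h$; $S^{2h}k^-$ is its transpose. $M_h^{+,\sigma}$ is the image in $(R^+)^{(2h+1)^3}$ of the Kronecker product $S^{2h}k_1^{\sigma_1}\otimes S^{2h}k_2^{\sigma_2}\otimes S^{2h}k_3^{\sigma_3}$, graded from the free module (generators in degree 0, $R^+$ graded by polynomial degree). $\widetilde M$ is the sheaf on $X^+$ with $\widetilde M(D_f)=M_f$, $D_f=\{f\ne0\}$; its sections over $X^+-Z_3$ form a graded $R^+$-module. Lorentz group: $SL(2,\mathbb C)\times SL(2,\mathbb C)\ni(A,B)$ acting on all $k_i$ simultaneously by $k_i\mapsto Ak_iB^T$ (preserving $I^+$), on the factor $\operatorname{im}S^{2h}k_i^+$ via $S^{2h}A$ and on $\operatorname{im}S^{2h}k_i^-$ via $S^{2h}B$; this makes $M$ and the restriction map equivariant. $\mathbf{(\tfrac12,0)}$ and $\mathbf{(0,\tfrac12)}$ denote the fundamental representations $\mathbb C^2$ of the first resp. second $SL(2,\mathbb C)$; $S^{2h}$ is the symmetric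 power. *)

(* Defs.v *)
From HB Require Import structures.
From mathcomp Require Import all_boot all_order all_algebra.
From mathcomp Require Import complex.
From mathcomp Require Import mpoly.
From mathcomp Require Import reals.
From Stdlib Require List.

Set Implicit Arguments.
Unset Strict Implicit.
Unset Printing Implicit Defensive.

Import Order.TTheory GRing.Theory Num.Theory.
Local Open Scope ring_scope.

Section Lorentz.

Variable F : fieldType.

Definition P := {mpoly F[12]}.

(* k_i = (a_i b_i ; c_i d_i); entry e = 0,1,2,3 <-> a,b,c,d ; i = 0,1,2 <-> k_1,k_2,k_3 *)
Definition kv (i : nat) (e : nat) : P := 'X_(inord (4 * i + e) : 'I_12).

(* columns of the 2x6 matrix (k_1 k_2 k_3): column p has top entry and bottom entry *)
Definition ktop (p : nat) : P := kv (p %/ 2) (p %% 2).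
Definition kbot (p : nat) : P := kv (p %/ 2) (2 + p %% 2).
Definition kminor (p q : nat) : P := ktop p * kbot q - ktop q * kbot p.

Definition gensI : seq P :=
  [seq kv 0 e + kv 1 e + kv 2 e | e <- iota 0 4] ++
  [seq kminor pq.1 pq.2 | pq <- [seq (p, q) | p <- iota 0 6, q <- iota 0 6] & pq.1 < pq.2]%N.

Definition inI (p : P) : Prop :=
  exists c : nat -> P, p = \sum_(j < size gensI) c j * gensI`_j.

Variable n : nat.  (* n = 2h *)

(* index set of (C^{2h+1})^{(x)3} *)
Definition Idx := ('I_n.+1 * 'I_n.+1 * 'I_n.+1)%type.
Definition Vec := Idx -> P.

(* S^{2h} k_i^{+} (s = true) and S^{2h} k_i^{-} (s = false, transpose) *)
Definition Sk (s : bool) (i : nat) (r c : 'I_n.+1) : P :=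
  let a := kv i 0 in let b := kv i 1 in let cc := kv i 2 in let d := kv i 3 in
  let r' := if s then (r : nat) else (c : nat) in
  let c' := if s then (c : nat) else (r : nat) in
  if (r' + c' <= n)%N then a ^+ (n - r' - c') * b ^+ c' * cc ^+ r'
  else b ^+ (n - r') * cc ^+ (n - c') * d ^+ (r' + c' - n).

Variable sigma : 'I_3 -> bool.  (* true = '+', false = '-' *)

Definition Kr (r c : Idx) : P :=
  Sk (sigma 0) 0 r.1.1 c.1.1 * Sk (sigma 1) 1 r.1.2 c.1.2 * Sk (sigma 2) 2 r.2 c.2.

(* equality in (R^+)^N of representatives *)
Definition eqVI (v w : Vec) : Prop := forall r, inI (v r - w r).

(* v represents an element of M = image of the Kronecker product in (R^+)^N *)
Definition inM (v : Vec) : Prop :=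
  exists c : Idx -> P, eqVI v (fun r => \sum_(col : Idx) c col * Kr r col).

Definition vadd (v w : Vec) : Vec := fun r => v r + w r.
Definition vscale (p : P) (v : Vec) : Vec := fun r => p * v r.
Definition vzero : Vec := fun _ => 0.

(* homogeneous element of degree d of the graded free module (generators in degree 0) *)
Definition homV (d : nat) (v : Vec) : Prop :=
  exists w : Vec, eqVI v w /\ forall r, w r \is d.-homog.

Definition genM (d : nat) : Prop :=
  forall v, inM v -> exists l : seq (P * Vec),
    (forall x, List.In x l -> inM x.2 /\ homV d x.2) /\
    eqVI v (foldr (fun x acc => vadd (vscale x.1 x.2) acc) vzero l).

(* fractions v/q with q a polynomial; equality in the localization M_h
   (h a polynomial such that the denominators are invertible in R^+_h) *)
Definition locEq (h : P) (x y : Vec * P) : Prop :=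
  exists l : nat, forall r, inI (h ^+ l * (y.2 * x.1 r - x.2 * y.1 r)).

(* basic open cover of X^+ - Z_3 : D_f, f = x_1 x_2 x_3 with x_i an entry of k_i *)
Definition CI := ('I_4 * 'I_4 * 'I_4)%type.
Definition cf (t : CI) : P := kv 0 t.1.1 * kv 1 t.1.2 * kv 2 t.2.

(* a family s_t = (m_t, e_t) represents m_t / (cf t)^e_t in M_{cf t} *)
Definition Fam := CI -> (Vec * nat).
Definition loc (s : Fam) (t : CI) : Vec * P := ((s t).1, cf t ^+ (s t).2).

(* sections of ~M over X^+ - Z_3 (sheaf condition for the cover) *)
Definition isSec (s : Fam) : Prop :=
  (forall t, inM (s t).1) /\
  (forall t t', locEq (cf t * cf t') (loc s t) (loc s t')).

Definition secEq (s s' : Fam) : Prop := forall t, locEq (cf t) (loc s t) (loc s' t).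

Definition res (v : Vec) : Fam := fun _ => (v, 0%N).

Definition sadd (s s' : Fam) : Fam := fun t =>
  (vadd (vscale (cf t ^+ (s' t).2) (s t).1) (vscale (cf t ^+ (s t).2) (s' t).1),
   ((s t).2 + (s' t).2)%N).
Definition sscale (p : P) (s : Fam) : Fam := fun t => (vscale p (s t).1, (s t).2).
Definition szero : Fam := fun _ => (vzero, 0%N).

(* homogeneity of degree d (an integer) of an element of M_{cf t}, deg cf t = 3 *)
Definition homLoc (t : CI) (d : int) (x : Vec * nat) : Prop :=
  exists y : Vec * nat, inM y.1 /\
    locEq (cf t) (x.1, cf t ^+ x.2) (y.1, cf t ^+ y.2) /\
    exists D : nat, (D%:Z = d + (3 * y.2)%N%:Z) /\ homV D y.1.

Definition homSec (d : int) (s : Fam) : Prop := forall t, homLoc t d (s t).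

Definition genSec (d : int) : Prop :=
  forall s, isSec s -> exists l : seq (P * Fam),
    (forall x, List.In x l -> isSec x.2 /\ homSec d x.2) /\
    secEq s (foldr (fun x acc => sadd (sscale x.1 x.2) acc) szero l).

Definition SL2 (A : 'M[F]_2) : Prop := \det A = 1.

(* S^{2h} A : the matrix with w(A u) = S^{2h}A w(u), w(u)_i = u_1^{2h-i} u_2^i *)
Definition symA (A : 'M[F]_2) (i l : 'I_n.+1) : F :=
  ((A ord0 ord0 *: 'X + (A ord0 ord_max)%:P) ^+ (n - i) *
   (A ord_max ord0 *: 'X + (A ord_max ord_max)%:P) ^+ i)`_(n - l).

Definition i2 (k : nat) : 'I_2 := inord k.

(* substitution k_i |-> A^{-1} k_i B^{-T} (i.e. p |-> p o g^{-1}) *)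
Definition substL (A B : 'M[F]_2) (j : 'I_12) : P :=
  let i := (j %/ 4)%N in let r := ((j %% 4) %/ 2)%N in let c := (j %% 2)%N in
  \sum_(u < 2) \sum_(v < 2)
     (invmx A (i2 r) u * invmx B (i2 c) v) *: kv i (2 * u + v).

Definition actP (A B : 'M[F]_2) (p : P) : P := p \mPo [tuple substL A B j | j < 12].

Definition rhoF (A B : 'M[F]_2) (t : 'I_3) : 'I_n.+1 -> 'I_n.+1 -> F :=
  if sigma t then symA A else symA B.
Definition rho (A B : 'M[F]_2) (r c : Idx) : F :=
  rhoF A B 0 r.1.1 c.1.1 * rhoF A B 1 r.1.2 c.1.2 * rhoF A B 2 r.2 c.2.

(* (g . v)(k) = rho(g) v(g^{-1} k) *)
Definition actV (A B : 'M[F]_2) (v : Vec) : Vec :=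
  fun r => \sum_(c : Idx) rho A B r c *: actP A B (v c).

(* s' = g . s : s' is a section agreeing with g.(s_t) (an element of M_{g.cf t})
   on every D_{cf t'} /\ D_{g.cf t} *)
Definition actRel (A B : 'M[F]_2) (s s' : Fam) : Prop :=
  isSec s' /\ forall t t',
    locEq (cf t' * actP A B (cf t)) (loc s' t')
          (actV A B (s t).1, actP A B (cf t) ^+ (s t).2).

(* S^{2h} of a representation V = C^m : homogeneous polynomials of degree 2h in
   the basis vectors e_1..e_m, g acting by the algebra map e_j |-> g e_j. *)
Definition actW (m : nat) (G : 'M[F]_m) (p : {mpoly F[m]}) : {mpoly F[m]} :=
  p \mPo [tuple \sum_(i < m) G i j *: 'X_i | j < m].

(* the matrix of (A,B) on (0,1/2) (+) (0,1/2) = C^2 (+) C^2 : diag(B, B) *)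
Definition gB2 (B : 'M[F]_2) : 'M[F]_4 :=
  \matrix_(i < 4, j < 4)
    (if ((i %/ 2) == (j %/ 2))%N then B (i2 (i %% 2)) (i2 (j %% 2)) else 0).

Definition repIso (d : int) (m : nat) (act : 'M[F]_2 -> 'M[F]_2 -> 'M[F]_m) : Prop :=
  exists Phi : Fam -> {mpoly F[m]},
    [/\ forall s, isSec s -> homSec d s -> Phi s \is n.-homog,
        forall s s', isSec s -> homSec d s -> isSec s' -> homSec d s' ->
          (secEq s s' <-> Phi s = Phi s'),
        forall (a b : F) s s', isSec s -> homSec d s -> isSec s' -> homSec d s' ->
          Phi (sadd (sscale a%:MP s) (sscale b%:MP s')) = a *: Phi s + b *: Phi s',
        forall p, p \is n.-homog -> exists s, [/\ isSec s, homSec d s & Phi s = p] &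
        forall A B s s', SL2 A -> SL2 B -> isSec s -> homSec d s ->
          actRel A B s s' -> Phi s' = actW (act A B) (Phi s)].

End Lorentz.

(* Main.v *)
(* A point of X^+ is a triple k_i = v w_i^T of rank one matrices with w_1 + w_2 + w_3 = 0, so
   R^+ is the Segre subring of C[v, w_1, w_2] spanned by the polynomials having equal degrees
   in v and in w.  There S^{2h} k_i^+ and S^{2h} k_i^- have rank one, with images spanned by the
   Veronese vectors of v and of w_i; hence every element of M is f * e for one fixed vector e,
   the tensor product of these.  The loci where a given k_i vanishes become {v = 0} and {w_i = 0},
   of codimension two in (v, w_1, w_2)-space, so sections over X^+ - Z_3 are exactly the f * e with
   f a polynomial such that deg_v f - deg_w f has the prescribed value.  The minimal generators have
   bidegree (0, b) or (a, 0): forms of degree 2h in w_1, w_2 or in v in the mixed cases. *)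
Require Import Defs.
From HB Require Import structures.
From mathcomp Require Import all_boot all_order all_algebra.
From mathcomp Require Import complex ssrcomplements mpoly reals boolp.
From mathcomp Require Import zify ring.
From Stdlib Require List.

Set Implicit Arguments.
Unset Strict Implicit.
Unset Printing Implicit Defensive.

Import Order.TTheory GRing.Theory Num.Theory.
Local Open Scope ring_scope.

(** * Polynomials homogeneous for an integral weight *)

(** The overview takes for granted that the listed generators of the ideal generate the whole kernel
    of the Segre map. That is the main obstacle: it is settled by a linear, non-multiplicative lift
    [nu] of balanced polynomials, shown to invert [segre] modulo the generators. From then on every
    equality in the ring or in a localization is an equality of polynomials in six variables, a
    domain where nonzero factors cancel. Extension over codimension two becomes divisibility: among
    the 64 charts, two have images of their denominators without common factor. Degree in the [k_i]
    turns into degree in [v] and degree in [w] at once. Hence a section [f * e] of degree [d] has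
    [f] of bidegree [(d - vd, d - wd)], where [(vd, wd)] is the bidegree of [e], that is [n] times
    the numbers of plus and of minus signs. The generating degree is the larger of [vd] and [wd];
    this is where [3n = 6h] and [2n = 4h] come from. Finally [e] is fixed by the Lorentz group, so
    the group only substitutes in [f]. *)

Section MpolyGeneralities.

Variable F : fieldType.

Lemma mpoly_alg_ind k (Q : {mpoly F[k]} -> Prop) :
  (forall c, Q c%:MP) -> (forall p q, Q p -> Q q -> Q (p + q)) ->
  (forall i p, Q p -> Q ('X_i * p)) -> forall p, Q p.
Proof.
move=> QC QD QX p; have Q0 : Q 0 by rewrite -(mpolyC0 k F); exact: QC.
suff QXm m q : Q q -> Q ('X_[m] * q).
  rewrite (mpolyE p); elim/big_ind: _ => // m _.
  by rewrite -mul_mpolyC mulrC; apply/QXm/QC.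
rewrite mpolyXE_id; move: q.
pose T x := forall q, Q q -> Q (x * q).
have T1 : T 1 by move=> q; rewrite mul1r.
have TM x y : T x -> T y -> T (x * y).
  by move=> Tx Ty q Qq; rewrite -mulrA; apply/Tx/Ty.
apply: (big_ind T) => // i _; elim: (m i) => [|j IH]; first by rewrite expr0.
by rewrite exprS; apply: TM IH => q; exact: QX.
Qed.

Lemma comp_mpoly_comp a b c (p : {mpoly F[a]}) (t : a.-tuple {mpoly F[b]})
    (u : b.-tuple {mpoly F[c]}) :
  (p \mPo t) \mPo u = p \mPo [tuple tnth t i \mPo u | i < a].
Proof.
elim/mpoly_alg_ind: p => [x|p q IHp IHq|i p IH].
- by rewrite !comp_mpolyC.
- by rewrite !raddfD /= IHp IHq.
- by rewrite !rmorphM /= IH !comp_mpolyXU -!tnth_nth tnth_mktuple.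
Qed.

Lemma comp_mpoly_modX k (i : 'I_k) (L p : {mpoly F[k]}) :
  exists q, p = p \mPo [tuple if j == i then L else 'X_j | j < k] + ('X_i - L) * q.
Proof.
set t := [tuple _ | _ < _].
elim/mpoly_alg_ind: p => [x|p q [p' Hp] [q' Hq]|j p [p' Hp]].
- by exists 0; rewrite comp_mpolyC mulr0 addr0.
- by exists (p' + q'); rewrite raddfD /= {1}Hp {1}Hq; ring.
- rewrite rmorphM /= comp_mpolyXU -tnth_nth tnth_mktuple.
  case: (altP (j =P i)) => [->|_].
    by exists (p \mPo t + 'X_i * p'); rewrite {1}Hp; ring.
  by exists ('X_j * p'); rewrite {1}Hp; ring.
Qed.

(* ['X_i - L] is prime as the kernel generator of a substitution, so it can be cancelled
   against any factor surviving that substitution. *)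
Lemma dvd_linear_form k (i : 'I_k) (L f g h : {mpoly F[k]}) :
  let t := [tuple if j == i then L else 'X_j | j < k] in
  L \mPo t = L -> h \mPo t != 0 -> ('X_i - L) * g = f * h ->
  exists f', f = ('X_i - L) * f'.
Proof.
move=> t Lt ht E; have [q Hq] := comp_mpoly_modX i L f.
exists q; rewrite {1}Hq; suff -> : f \mPo t = 0 by rewrite add0r.
apply: (mulIf ht); rewrite mul0r -rmorphM /= -E rmorphM rmorphB /= Lt.
by rewrite comp_mpolyXU -tnth_nth tnth_mktuple eqxx subrr mul0r.
Qed.

(** Weights may be negative, so that one notion covers total degree, the degrees in [v] and in [w],
    and the difference of the latter two. *)
Definition wt k (c : 'I_k -> int) (m : 'X_{1..k}) : int := \sum_i c i * (m i)%:Z.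

Definition whom k (c : 'I_k -> int) (d : int) (p : {mpoly F[k]}) : Prop :=
  forall m, p@_m != 0 -> wt c m = d.

Section Weights.

Variables (k : nat) (c : 'I_k -> int).

Lemma wtD m m' : wt c (m + m')%MM = wt c m + wt c m'.
Proof.
by rewrite /wt -big_split; apply: eq_bigr => i _; rewrite mnmDE PoszD mulrDr.
Qed.

Lemma wt0 : wt c 0%MM = 0.
Proof. by rewrite /wt big1 // => i _; rewrite mnm0E mulr0. Qed.

Lemma wt1 i : wt c U_(i)%MM = c i.
Proof.
rewrite /wt (bigD1 i) //= mnm1E eqxx mulr1 big1 ?addr0 // => j ji.
by rewrite mnm1E eq_sym (negPf ji) mulr0.
Qed.

Lemma whom0 d : whom c d 0.
Proof. by move=> m; rewrite mcoeff0 eqxx. Qed.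

Lemma whomD d p q : whom c d p -> whom c d q -> whom c d (p + q).
Proof.
move=> hp hq m; rewrite mcoeffD; case: (altP (p@_m =P 0)) => [->|/hp //].
by rewrite add0r => /hq.
Qed.

Lemma whomZ d a p : whom c d p -> whom c d (a *: p).
Proof. by move=> hp m; rewrite mcoeffZ mulf_eq0 negb_or => /andP[_ /hp]. Qed.

Lemma whomN d p : whom c d p -> whom c d (- p).
Proof. by move=> hp m; rewrite mcoeffN oppr_eq0 => /hp. Qed.

Lemma whom_sum I (r : seq I) (Q : pred I) (G : I -> {mpoly F[k]}) d :
  (forall i, Q i -> whom c d (G i)) -> whom c d (\sum_(i <- r | Q i) G i).
Proof. by move=> h; elim/big_ind: _ => //; [exact: whom0 | exact: whomD]. Qed.

Lemma whomXm m : whom c (wt c m) 'X_[m].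
Proof. by move=> m'; rewrite mcoeffX; case: (m =P m') => [->|_]; rewrite ?eqxx. Qed.

Lemma whomX i : whom c (c i) 'X_i.
Proof. by have := @whomXm U_(i)%MM; rewrite wt1. Qed.

Lemma whom1 : whom c 0 1.
Proof. by have := @whomXm 0%MM; rewrite wt0 mpolyX0. Qed.

Lemma whomM d e p q : whom c d p -> whom c e q -> whom c (d + e) (p * q).
Proof.
move=> hp hq; rewrite (mpolyE p) mulr_suml big_seq.
apply: whom_sum => m; rewrite mcoeff_msupp => /hp <-.
rewrite (mpolyE q) mulr_sumr big_seq; apply: whom_sum => m'.
rewrite mcoeff_msupp => /hq <-; rewrite -scalerAl -scalerAr -mpolyXD -wtD.
by do 2!apply: whomZ; exact: whomXm.
Qed.

Lemma whom_exp d p j : whom c d p -> whom c (d * j%:Z) (p ^+ j).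
Proof.
move=> hp; elim: j => [|j IH]; first by rewrite mulr0 expr0; exact: whom1.
by rewrite exprS intS mulrDr mulr1; exact: whomM.
Qed.

Definition wpart (d : int) (p : {mpoly F[k]}) : {mpoly F[k]} :=
  \sum_(m <- msupp p | wt c m == d) p@_m *: 'X_[m].

Lemma mcoeff_wpart d p m : (wpart d p)@_m = if wt c m == d then p@_m else 0.
Proof.
rewrite raddf_sum /=.
under eq_bigr do rewrite mcoeffZ mcoeffX.
case: (boolP (m \in msupp p)) => hm.
  case: ifP => hw; last first.
    rewrite big1 // => m' hw'; case: eqP => [E|]; last by rewrite mulr0.
    by rewrite -E hw' in hw.
  rewrite -big_filter (bigD1_seq m) /=; last first.
  - exact/filter_uniq/msupp_uniq.
  - by rewrite mem_filter hw.
  rewrite eqxx mulr1 big1 ?addr0 // => m' /negPf ->; exact: mulr0.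
have -> : p@_m = 0 by apply/eqP; rewrite mcoeff_eq0.
rewrite if_same big_seq_cond big1 // => m' /andP[hm' _].
by case: eqP => [E|]; [rewrite -E hm' in hm | rewrite mulr0].
Qed.

Lemma wpart_whom d p : whom c d (wpart d p).
Proof. by move=> m; rewrite mcoeff_wpart; case: ifP => [/eqP //|_]; rewrite eqxx. Qed.

Lemma wpartD d p q : wpart d (p + q) = wpart d p + wpart d q.
Proof.
apply/mpolyP=> m; rewrite mcoeffD !mcoeff_wpart mcoeffD.
by case: ifP; rewrite ?addr0.
Qed.

Lemma wpart0 d : wpart d 0 = 0.
Proof. by apply/mpolyP=> m; rewrite mcoeff_wpart !mcoeff0 if_same. Qed.

Lemma wpart_id d p : whom c d p -> wpart d p = p.
Proof.
move=> h; apply/mpolyP => m; rewrite mcoeff_wpart; case: eqP => // hw.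
by apply/esym/eqP; case: (altP (p@_m =P 0)) => // /h.
Qed.

Lemma wpart_neq d e p : whom c e p -> e != d -> wpart d p = 0.
Proof.
move=> h ed; apply/mpolyP => m; rewrite mcoeff_wpart mcoeff0; case: eqP => // hw.
by case: (altP (p@_m =P 0)) => // /h; rewrite hw => E; rewrite E eqxx in ed.
Qed.

Lemma wpart_mul d e p g : whom c e g -> wpart (d + e) (p * g) = wpart d p * g.
Proof.
move=> hg; rewrite (mpolyE p); elim/big_ind: _ => [|x y Hx Hy|m _].
- by rewrite mul0r !wpart0 mul0r.
- by rewrite mulrDl !wpartD mulrDl Hx Hy.
have hX := whomZ (a := p@_m) (@whomXm m).
case: (altP (wt c m =P d)) => [E|E].
  by rewrite E in hX; rewrite (wpart_id hX) wpart_id //; exact: whomM.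
by rewrite (wpart_neq hX E) mul0r (wpart_neq (whomM hX hg)) //; lia.
Qed.

(** Taking weight components commutes with multiplication by a homogeneous [g], so
    [wpart d p * g = p * g], and [g] cancels. This reads off the degree of a coefficient from that
    of a multiple. *)
Lemma whom_div d e p g : g != 0 -> whom c (d + e) (p * g) -> whom c e g -> whom c d p.
Proof.
move=> g0 hpg hg; suff <- : wpart d p = p by exact: wpart_whom.
by apply: (mulIf g0); rewrite -(wpart_mul _ _ hg) (wpart_id hpg).
Qed.

End Weights.

Lemma whom_comp a b (c : 'I_a -> int) (c' : 'I_b -> int) (t : a.-tuple {mpoly F[b]})
    (p : {mpoly F[a]}) d :
  (forall i, whom c' (c i) (tnth t i)) -> whom c d p -> whom c' d (p \mPo t).
Proof.
move=> ht hp; rewrite comp_mpolyEX; rewrite big_seq; apply: whom_sum => m.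
rewrite mcoeff_msupp => /hp <-; apply: whomZ; rewrite comp_mpolyX /wt.
rewrite /index_enum; elim: (Finite.enum _) => [|i r IH].
  by rewrite !big_nil; exact: whom1.
by rewrite !big_cons; apply: whomM IH; exact: whom_exp.
Qed.

Lemma wt_const1 k (m : 'X_{1..k}) : wt (fun=> 1) m = (mdeg m)%:Z.
Proof.
by rewrite /wt mdegE; elim/big_rec2: _ => //= i x y _ ->; rewrite mul1r.
Qed.

Lemma whom_dhomog k d (p : {mpoly F[k]}) : whom (fun=> 1) d%:Z p <-> p \is d.-homog.
Proof.
split=> [h|/dhomogP h m]; last by rewrite -mcoeff_msupp wt_const1 => /h ->.
apply/dhomogP => m; rewrite mcoeff_msupp => /h.
by rewrite wt_const1 => -[].
Qed.

Lemma whom_subw k (c c' : 'I_k -> int) d d' p :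
  whom c d p -> whom c' d' p -> whom (fun i => c i - c' i) (d - d') p.
Proof.
move=> h h' m pm; rewrite -(h m pm) -(h' m pm) /wt -sumrB.
by apply: eq_bigr => i _; rewrite mulrBl.
Qed.

End MpolyGeneralities.

(** * The kernel of the Segre map *)

Section SegreModel.

Variable F : fieldType.
Notation P := (P F).
Notation S := {mpoly F[6]}.

Lemma inI_0 : @inI F 0.
Proof. by exists (fun=> 0); rewrite big1 // => i _; rewrite mul0r. Qed.

Lemma inI_D (p q : P) : inI p -> inI q -> inI (p + q).
Proof.
move=> [c ->] [c' ->]; exists (fun j => c j + c' j).
by rewrite -big_split; apply: eq_bigr => i _; rewrite mulrDl.
Qed.

Lemma inI_M (p q : P) : inI q -> inI (p * q).
Proof.
move=> [c ->]; exists (fun j => p * c j).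
by rewrite mulr_sumr; apply: eq_bigr => i _; rewrite mulrA.
Qed.

Lemma inI_N (p : P) : inI p -> inI (- p).
Proof. by rewrite -mulN1r; exact: inI_M. Qed.

Lemma inI_gen (g : P) : g \in gensI F -> inI g.
Proof.
rewrite /inI; move: (gensI F) => G hg.
have hi : (index g G < size G)%N by rewrite index_mem.
exists (fun j => (j == index g G)%:R).
rewrite (bigD1 (Ordinal hi)) //= eqxx mul1r nth_index // big1 ?addr0 // => j ji.
by rewrite -val_eqE /= in ji; rewrite (negPf ji) mul0r.
Qed.

Lemma inI_trace e : (e < 4)%N -> inI (@kv F 0 e + kv F 1 e + kv F 2 e).
Proof.
move=> he; apply: inI_gen; rewrite mem_cat; apply/orP; left.
by apply/mapP; exists e; rewrite ?mem_iota.
Qed.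

Lemma inI_minor p q : (p < 6)%N -> (q < 6)%N -> inI (kminor F p q).
Proof.
move=> hp hq.
wlog pq : p q hp hq / (p < q)%N => [H|].
  case: (ltngtP p q) => [|qp|->]; first exact: H.
    have -> : kminor F p q = - kminor F q p by rewrite /kminor; ring.
    by apply: inI_N; exact: H.
  have -> : kminor F q q = 0 by rewrite /kminor; ring.
  exact: inI_0.
apply: inI_gen; rewrite mem_cat; apply/orP; right.
apply/mapP; exists (p, q) => //; rewrite mem_filter; apply/andP; split=> //.
by apply/allpairsP; exists (p, q); rewrite !mem_iota.
Qed.

(** * Straightening products of matrix entries modulo the minors *)

Definition cong (p q : P) := inI (p - q).

Lemma cong_refl p : cong p p.
Proof. by rewrite /cong subrr; exact: inI_0. Qed.

Lemma cong_sym p q : cong p q -> cong q p.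
Proof. by move=> /inI_N; rewrite opprB. Qed.

Lemma cong_trans q p r : cong p q -> cong q r -> cong p r.
Proof. by move=> h1 h2; have := inI_D h1 h2; rewrite addrA subrK. Qed.

Lemma cong_mull r p q : cong p q -> cong (r * p) (r * q).
Proof. by rewrite /cong -mulrBr; exact: inI_M. Qed.

(** For [k] the entries of a matrix, this is a monomial in them, given by its list of row indices
    and its list of column indices. The overhang of a longer list is ignored. *)
Fixpoint zprod (A B : Type) (k : A -> B -> P) (s : seq A) (t : seq B) : P :=
  match s, t with
  | a :: s', b :: t' => k a b * zprod k s' t'
  | _, _ => 1
  end.

Lemma zprod_flip (A B : Type) (k : A -> B -> P) s t :
  zprod (fun b a => k a b) t s = zprod k s t.
Proof. by elim: s t => [|a s IH] [|b t] //=; rewrite IH. Qed.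

Section Exchange.

Variables (A B : eqType) (k : A -> B -> P).
Hypothesis exch : forall a a' b b', cong (k a b * k a' b') (k a b' * k a' b).

(** By induction [b] can be brought to the second factor; one exchange between the first two
    factors, which is a vanishing minor, then pairs it with [a]. *)
Lemma zprod_front a s b t : b \in t -> size t = (size s).+1 ->
  cong (zprod k (a :: s) t) (k a b * zprod k s (rem b t)).
Proof.
elim: s a t => [|a' s IH] a [|b0 t] //=.
  rewrite inE; case: eqP => [->|_] /=; first by move=> _ _; exact: cong_refl.
  by case: t.
rewrite inE eq_sym; case: eqP => [->|_] /= => [_ _|bt [st]]; first exact: cong_refl.
apply: cong_trans (cong_mull _ (IH a' t bt st)) _.
rewrite mulrA [X in cong _ X]mulrA mulrC [X in cong _ X]mulrC.
exact: cong_mull.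
Qed.

End Exchange.

(** Modulo the minors a monomial depends only on the multisets of its row and column indices: the
    head pair [(a, b)] of the target is moved to the front, first within the columns, then within
    the rows. *)
Lemma zprod_perm (A B : eqType) (k : A -> B -> P) :
  (forall a a' b b', cong (k a b * k a' b') (k a b' * k a' b)) ->
  forall s t s' t', size s = size t -> perm_eq s s' -> perm_eq t t' ->
  cong (zprod k s t) (zprod k s' t').
Proof.
move=> exch s t s'; elim: s' s t => [|a s' IH] s t t' st ss' tt'.
  have s0 := perm_size ss'; case: s s0 st {ss'} => // _ [] /esym/size0nil t0.
  by rewrite t0; exact: cong_refl.
have := perm_size ss'; have := perm_size tt'; rewrite -st => /[swap] -> /=.
case: t' tt' => // b t' tt' _.
have sa : a \in s by rewrite (perm_mem ss') mem_head.
have tb : b \in t by rewrite (perm_mem tt') mem_head.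
case: s ss' st sa => // a0 s ss' st sa.
apply: cong_trans (zprod_front exch _ tb (esym st)) _.
(* Exchanging the roles of rows and columns lets [zprod_front] bring [a] forward while [b] stays in
   front. *)
rewrite -[k a0 b * _]/(zprod k (a0 :: s) (b :: rem b t)) -zprod_flip.
have exch' b1 b2 a1 a2 :
    cong (k a1 b1 * k a2 b2) (k a2 b1 * k a1 b2).
  by rewrite [k a2 b1 * _]mulrC; exact: exch.
have hs : size (a0 :: s) = (size (rem b t)).+1.
  by rewrite size_rem // -st.
apply: cong_trans (zprod_front (k := fun b a => k a b) exch' b sa hs) _.
rewrite zprod_flip; apply/cong_mull/IH.
- by rewrite size_rem // hs.
- by rewrite -(perm_cons a) -(permPl (perm_to_rem sa)).
- by rewrite -(perm_cons b) -(permPl (perm_to_rem tb)).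
Qed.

(** Of the six variables, 0 and 1 are the coordinates of [v], 2 and 3 those of [w_1], 4 and 5 those
    of [w_2]; [w_3] is eliminated as [-(w_1 + w_2)]. *)
Definition Vx (a : nat) : S := 'X_(inord a).
Definition Ux (b : nat) : S := 'X_(inord (2 + b)).
Definition Wx (i b : nat) : S :=
  if i == 2%N then - (Ux b + Ux (2 + b)) else Ux (2 * i + b).

(* [X^+] is the set of triples [k_i = v w_i^T] with [w_1 + w_2 + w_3 = 0]; [segre] is
   the comorphism of the parametrization by [v], [w_1], [w_2]. *)
Definition segre (p : P) : S :=
  p \mPo [tuple Vx (j %% 4 %/ 2) * Wx (j %/ 4) (j %% 2) | j < 12].

HB.instance Definition _ := GRing.RMorphism.copy segre
  (comp_mpoly [tuple Vx (j %% 4 %/ 2) * Wx (j %/ 4) (j %% 2) | j < 12]).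

Lemma segreZ c p : segre (c *: p) = c *: segre p.
Proof. exact: comp_mpolyZ. Qed.

Lemma segre_kv i e : (i < 3)%N -> (e < 4)%N ->
  segre (kv F i e) = Vx (e %/ 2) * Wx i (e %% 2).
Proof.
move=> hi he; rewrite /segre /kv comp_mpolyXU -tnth_nth tnth_mktuple.
rewrite inordK; last by lia.
have -> : ((4 * i + e) %% 4 = e)%N by lia.
have -> : ((4 * i + e) %/ 4 = i)%N by lia.
by have -> : ((4 * i + e) %% 2 = e %% 2)%N by lia.
Qed.

Lemma segre_trace e : (e < 4)%N -> segre (kv F 0 e + kv F 1 e + kv F 2 e) = 0.
Proof.
move=> he; rewrite !rmorphD /= !segre_kv // /Wx /= muln0 add0n muln1; ring.
Qed.

Lemma segre_minor p q : (p < 6)%N -> (q < 6)%N -> segre (kminor F p q) = 0.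
Proof.
move=> hp hq; rewrite /kminor /ktop /kbot rmorphB !rmorphM /= !segre_kv; try lia.
have E e : ((2 + e %% 2) %/ 2 = 1)%N by lia.
have E' e : ((2 + e %% 2) %% 2 = e %% 2)%N by lia.
have E2 e : (e %% 2 %/ 2 = 0)%N by lia.
rewrite !E !E' !E2 !modn_mod; ring.
Qed.

Lemma segre_inI p : inI p -> segre p = 0.
Proof.
have H g : g \in gensI F -> segre g = 0.
  rewrite mem_cat => /orP[] /mapP.
    by move=> [e]; rewrite mem_iota => he ->; exact: segre_trace.
  move=> [x]; rewrite mem_filter => /andP[_ /allpairsP[y [h1 h2 ->]]] ->.
  by rewrite !mem_iota in h1 h2; exact: segre_minor.
move=> [c ->]; rewrite (rmorph_sum segre) big1 // => j _.
rewrite (rmorphM segre); apply: etrans (mulr0 (segre (c j))).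
by congr (_ * _); apply/H/mem_nth/ltn_ord.
Qed.

(** Row [a], column [b] of the matrix [(k_1 k_2)]. Leaving out [k_3], which the trace relations
    express by the others, makes [segre] send each entry to a monomial. *)
Definition kk (a : bool) (b : 'I_4) : P := kv F (b %/ 2) (2 * a + b %% 2).

Lemma kk_exch a a' b b' : cong (kk a b * kk a' b') (kk a b' * kk a' b).
Proof.
have hb (c : 'I_4) : (c < 6)%N by apply: leq_trans (ltn_ord c) _.
have E : kminor F b b' = kk false b * kk true b' - kk false b' * kk true b.
  by rewrite /kminor /ktop /kbot /kk /= muln0 muln1 !add0n.
have := inI_minor (hb b) (hb b'); rewrite E; case: a; case: a' => h.
- by rewrite mulrC; exact: cong_refl.
- apply: cong_sym; rewrite mulrC [X in cong _ X]mulrC; exact: h.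
- exact: h.
- by rewrite mulrC; exact: cong_refl.
Qed.

Definition iv (a : bool) : 'I_6 := inord a.
Definition iw (b : 'I_4) : 'I_6 := inord (2 + b).

Lemma iv_val a : iv a = a :> nat.
Proof. by rewrite /iv inordK //; case: a. Qed.

Lemma iw_val b : iw b = (2 + b)%N :> nat.
Proof. by rewrite /iw inordK //; have := ltn_ord b; lia. Qed.

Lemma segre_kk a b : segre (kk a b) = 'X_(iv a) * 'X_(iw b).
Proof.
have hb := ltn_ord b.
rewrite /kk segre_kv; [|by lia|by case: a; lia].
have -> : ((2 * a + b %% 2) %/ 2 = a)%N by case: a; lia.
rewrite /Wx ifF; last by apply/negbTE; lia.
by rewrite /Ux; have -> : (2 * (b %/ 2) + (2 * a + b %% 2) %% 2 = b)%N by case: a; lia.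
Qed.

Definition vseq (m : 'X_{1..6}) : seq bool :=
  nseq (m (iv false)) false ++ nseq (m (iv true)) true.
Definition wseq (m : 'X_{1..6}) : seq 'I_4 :=
  flatten [seq nseq (m (iw b)) b | b <- enum 'I_4].

Lemma count_vseq m a : count_mem a (vseq m) = m (iv a).
Proof. by rewrite /vseq count_cat !count_nseq /=; case: a; rewrite /= !mul1n !mul0n ?addn0. Qed.

Lemma count_wseq m b : count_mem b (wseq m) = m (iw b).
Proof.
rewrite /wseq count_flatten -map_comp sumnE big_map big_enum /=.
rewrite (bigD1 b) //= count_nseq /= eqxx mul1n big1 ?addn0 // => b' /negPf h.
by rewrite count_nseq /= h mul0n.
Qed.

Definition cv (i : 'I_6) : int := if (i < 2)%N then 1 else 0.
Definition cw (i : 'I_6) : int := if (i < 2)%N then 0 else 1.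

Lemma big_I6 (R : Type) (idx : R) (op : Monoid.com_law idx) (G : 'I_6 -> R) :
  \big[op/idx]_(i < 6) G i =
  op (op (G (iv false)) (G (iv true))) (\big[op/idx]_(b < 4) G (iw b)).
Proof.
rewrite big_ord_recl big_ord_recl Monoid.mulmA; congr (op (op _ _) _).
- by congr G; apply: val_inj; rewrite /= iv_val.
- by congr G; apply: val_inj; rewrite /= iv_val.
- by apply: eq_bigr => b _; congr G; apply: val_inj; rewrite /= iw_val.
Qed.

Lemma size_vseq m : (size (vseq m))%:Z = wt cv m.
Proof.
rewrite /wt big_I6 /= /vseq size_cat !size_nseq /cv !iv_val /= !mul1r PoszD.
by rewrite big1 ?addr0 // => b _; rewrite iw_val mul0r.
Qed.

Lemma size_wseq m : (size (wseq m))%:Z = wt cw m.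
Proof.
rewrite /wt big_I6 /= /wseq size_flatten /shape -map_comp sumnE big_map big_enum /=.
rewrite /cw !iv_val /= !mul0r !add0r.
elim/big_rec2: _ => // b x y _ <-.
by rewrite PoszD size_nseq iw_val mul1r.
Qed.

Lemma prod_vseq m : \prod_(a <- vseq m) 'X_(iv a) =
  'X_(iv false) ^+ m (iv false) * 'X_(iv true) ^+ m (iv true) :> S.
Proof. by rewrite /vseq big_cat !big_nseq !iter_mulr_1. Qed.

Lemma prod_wseq m : \prod_(b <- wseq m) 'X_(iw b) =
  \prod_(b < 4) 'X_(iw b) ^+ m (iw b) :> S.
Proof.
rewrite /wseq big_flatten big_map big_enum /=; apply: eq_bigr => b _.
by rewrite big_nseq iter_mulr_1.
Qed.

Lemma segre_zprod s t : size s = size t ->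
  segre (zprod kk s t) = \prod_(a <- s) 'X_(iv a) * \prod_(b <- t) 'X_(iw b).
Proof.
elim: s t => [|a s IH] [|b t] //= => [_|[st]].
  by rewrite !big_nil mulr1 rmorph1.
by rewrite rmorphM /= segre_kk IH // !big_cons; ring.
Qed.

(** A chosen lift of the monomial [m]: its [v]-variables and its [w]-variables, each listed in a
    fixed order, are paired off. It is meaningful when the two degrees agree. *)
Definition zmon (m : 'X_{1..6}) : P := zprod kk (vseq m) (wseq m).

Lemma segre_zmon m : wt cv m = wt cw m -> segre (zmon m) = 'X_[m].
Proof.
rewrite -size_vseq -size_wseq => -[E].
by rewrite segre_zprod // prod_vseq prod_wseq [RHS]mpolyXE_id big_I6.
Qed.

Lemma zmon_mul m a b : wt cv m = wt cw m ->
  cong (zmon (U_(iv a) + U_(iw b) + m)) (kk a b * zmon m).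
Proof.
rewrite -size_vseq -size_wseq => -[E].
have nvw a' b' : (iv a' == iw b') = false.
  by apply/negP => /eqP/(congr1 val); rewrite /= iv_val iw_val; case: a'.
have iv_inj a1 a2 : (iv a1 == iv a2) = (a1 == a2).
  by rewrite -val_eqE /= !iv_val; case: a1; case: a2.
have iw_inj b1 b2 : (iw b1 == iw b2) = (b1 == b2).
  by rewrite -val_eqE /= !iw_val eqn_add2l.
set m' := (_ + m)%MM.
have pv : perm_eq (vseq m') (a :: vseq m).
  apply/allP => x _; apply/eqP; rewrite /= !count_vseq !mnmDE !mnm1E.
  by rewrite iv_inj eq_sym (eq_sym (iw b)) nvw addn0.
have pw : perm_eq (wseq m') (b :: wseq m).
  apply/allP => x _; apply/eqP; rewrite /= !count_wseq !mnmDE !mnm1E.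
  by rewrite iw_inj nvw.
apply: (zprod_perm kk_exch _ pv pw).
by rewrite (perm_size pv) (perm_size pw) /= E.
Qed.

Definition nu (p : S) : P := \sum_(m <- msupp p) p@_m *: zmon m.

(** A range of summation that does not depend on the support makes linearity of [nu] a termwise
    check. *)
Lemma nuwE w p : (msize p <= w)%N ->
  nu p = \sum_(m : 'X_{1..6 < w}) p@_m *: zmon m.
Proof.
move=> le_pw; set I : subFinType _ := 'X_{1..6 < w}.
rewrite /nu (big_mksub I) ?msupp_uniq //=; first last.
  by move=> x /msize_mdeg_lt /leq_trans; apply.
by rewrite big_rmcond //= => j /memN_msupp_eq0 ->; rewrite scale0r.
Qed.

Lemma nuD p q : nu (p + q) = nu p + nu q.
Proof.
pose w := maxn (msize (p + q)) (maxn (msize p) (msize q)).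
rewrite !(nuwE (w := w)) /w ?leq_max ?leqnn ?orbT // -big_split.
by apply: eq_bigr => m _; rewrite mcoeffD scalerDl.
Qed.

Lemma nuZ c p : nu (c *: p) = c *: nu p.
Proof.
pose w := maxn (msize (c *: p)) (msize p).
rewrite !(nuwE (w := w)) /w ?leq_max ?leqnn ?orbT // scaler_sumr.
by apply: eq_bigr => m _; rewrite mcoeffZ scalerA.
Qed.

Lemma nuX m : nu 'X_[m] = zmon m.
Proof. by rewrite /nu msuppX big_seq1 mcoeffX eqxx scale1r. Qed.

Lemma nu0 : nu 0 = 0.
Proof. by rewrite /nu (_ : 0 = 0%:MP) ?mpolyC0 // msupp0 big_nil. Qed.

Lemma nuN p : nu (- p) = - nu p.
Proof. by rewrite -scaleN1r nuZ scaleN1r. Qed.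

(** The degree in [v] minus the degree in [w]. Value 0 characterizes the image of [segre];
    coefficients of sections have value [wd - vd]. *)
Definition bal (d : int) (p : S) : Prop := whom (fun i => cv i - cw i) d p.

Lemma balP d p m : bal d p -> p@_m != 0 -> wt cv m - wt cw m = d.
Proof.
move=> h /h <-; rewrite /wt -sumrB; apply: eq_bigr => i _.
by rewrite mulrBl.
Qed.

Lemma segre_nu p : bal 0 p -> segre (nu p) = p.
Proof.
move=> bp; rewrite [RHS]mpolyE /nu (rmorph_sum segre) /= big_seq [RHS]big_seq.
apply: eq_bigr => m; rewrite mcoeff_msupp => /(balP bp)/eqP.
by rewrite subr_eq0 => /eqP E; rewrite segreZ segre_zmon.
Qed.

Lemma nu_mul p a b : bal 0 p -> cong (nu ('X_(iv a) * 'X_(iw b) * p)) (kk a b * nu p).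
Proof.
move=> bp; rewrite [X in nu (_ * X)]mpolyE {2}/nu !mulr_sumr.
rewrite (big_morph nu nuD nu0) big_seq [X in cong _ X]big_seq /cong -sumrB.
elim/big_ind: _ => [||m]; [exact: inI_0 | exact: inI_D |].
rewrite mcoeff_msupp => /(balP bp)/eqP; rewrite subr_eq0 => /eqP E.
rewrite -!scalerAr -!mpolyXD nuZ nuX -scalerBr -mul_mpolyC.
exact/inI_M/zmon_mul.
Qed.

Lemma bal_kv j e : (j < 3)%N -> (e < 4)%N -> bal 0 (segre (kv F j e)).
Proof.
move=> hj he; rewrite segre_kv //; rewrite -[0](addrN 1); apply: whomM.
  have -> : 1 = cv (inord (e %/ 2)) - cw (inord (e %/ 2)).
    by rewrite /cv /cw inordK ?ifT //; lia.
  exact: whomX.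
have U b : (b < 4)%N -> bal (- 1) (Ux b).
  move=> hb; have -> : -1 = cv (inord (2 + b)) - cw (inord (2 + b)).
    by rewrite /cv /cw inordK ?ifF //; lia.
  exact: whomX.
rewrite /Wx; case: ifP => hj2; last by apply: U; lia.
by apply/whomN/whomD; apply: U; lia.
Qed.

Lemma kv_cover (i : 'I_12) : 'X_i = kv F (i %/ 4) (i %% 4).
Proof.
by rewrite /kv; congr 'X_(_); apply: val_inj; rewrite /= inordK; have := ltn_ord i; lia.
Qed.

Lemma bal_segre p : bal 0 (segre p).
Proof.
apply: (whom_comp (c := fun=> 0)) => [i|m _]; last by rewrite /wt big1 // => i; rewrite mul0r.
have -> : tnth [tuple Vx (j %% 4 %/ 2) * Wx (j %/ 4) (j %% 2) | j < 12] i =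
    segre 'X_i by rewrite /segre comp_mpolyXU -tnth_nth.
rewrite kv_cover.
by apply: bal_kv; have := ltn_ord i; lia.
Qed.

(** Every [p] is congruent to [nu (segre p)], by induction on the way [p] is built: [nu] is linear,
    and by [nu_mul] it respects multiplication by an entry of [k_1] or [k_2]. With [segre_inI] the
    ideal is the kernel of a map to a domain, hence prime. *)
Lemma inI_ker p : segre p = 0 -> inI p.
Proof.
move=> p0; suff : cong p (nu (segre p)) by rewrite /cong p0 nu0 subr0.
have inIK q g : inI g -> cong q (nu (segre q)) -> cong (g + q) (nu (segre (g + q))).
  move=> hg hq; rewrite (rmorphD segre) /= (segre_inI hg) add0r.
  by rewrite /cong -addrA; exact: inI_D.
have GD p' q' : cong p' (nu (segre p')) -> cong q' (nu (segre q')) ->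
    cong (p' + q') (nu (segre (p' + q'))).
  move=> h h'; rewrite rmorphD /= nuD /cong opprD addrACA; exact: inI_D.
have GN p' : cong p' (nu (segre p')) -> cong (- p') (nu (segre (- p'))).
  by move=> h; rewrite rmorphN /= nuN /cong -opprD; exact: inI_N.
have Gk a b p' : cong p' (nu (segre p')) ->
    cong (kk a b * p') (nu (segre (kk a b * p'))).
  move=> h; rewrite rmorphM /= segre_kk.
  apply: cong_trans (cong_mull _ h) _; apply: cong_sym; apply: nu_mul.
  exact: bal_segre.
have Gkv j e p' : (j < 2)%N -> (e < 4)%N -> cong p' (nu (segre p')) ->
    cong (kv F j e * p') (nu (segre (kv F j e * p'))).
  move=> hj he; have hb : (2 * j + e %% 2 < 4)%N by lia.
  have -> : kv F j e = kk (e %/ 2 == 1)%N (Ordinal hb); last exact: Gk.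
  by rewrite /kk /=; congr (kv F _ _); lia.
elim/mpoly_alg_ind: p {p0} => [x|p q|i p IH]; last first.
- have hi := ltn_ord i; rewrite kv_cover.
  have he : (i %% 4 < 4)%N by lia.
  case: (ltnP (i %/ 4) 2) => hj; first exact: Gkv.
  have -> : (i %/ 4 = 2)%N by lia.
  set e := (i %% 4)%N.
  (* An entry of [k_3] is traded for entries of [k_1] and [k_2] through the trace relation. *)
  have -> : kv F 2 e * p = p * (kv F 0 e + kv F 1 e + kv F 2 e) +
    (- (kv F 0 e * p) - kv F 1 e * p) by ring.
  apply: inIK; first exact/inI_M/inI_trace.
  by apply: GD; apply/GN/Gkv.
- exact: GD.
have -> : segre x%:MP = x *: 'X_[0] by rewrite /segre comp_mpolyC mpolyX0 alg_mpolyC.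
rewrite nuZ nuX; have -> : zmon 0 = 1.
  by rewrite /zmon /vseq !mnm0E.
by rewrite alg_mpolyC; exact: cong_refl.
Qed.

(** * Sections as polynomials *)

Lemma Vx_neq0 a : Vx a != 0.
Proof.
apply/eqP => /(congr1 (mcoeff U_(inord a)%MM))/eqP.
by rewrite mcoeffXU mcoeff0 eqxx oner_eq0.
Qed.

Lemma Ux_neq0 b : Ux b != 0.
Proof.
apply/eqP => /(congr1 (mcoeff U_(inord (2 + b))%MM))/eqP.
by rewrite mcoeffXU mcoeff0 eqxx oner_eq0.
Qed.

Lemma Wx_neq0 i b : (b < 2)%N -> Wx i b != 0.
Proof.
move=> hb; rewrite /Wx; case: ifP => _; last exact: Ux_neq0.
rewrite oppr_eq0; apply/eqP => /(congr1 (mcoeff U_(inord (2 + b))%MM))/eqP.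
rewrite mcoeffD !mcoeffXU mcoeff0 eqxx -val_eqE /= !inordK; try lia.
have -> : (2 + (2 + b) == 2 + b)%N = false by lia.
by rewrite addr0 oner_eq0.
Qed.

Lemma Vx_cv a : (a < 2)%N -> whom cv 1 (Vx a).
Proof.
by move=> ha; have := @whomX F 6 cv (inord a); rewrite {2}/cv inordK ?ha //; lia.
Qed.

Lemma Vx_cw a : (a < 2)%N -> whom cw 0 (Vx a).
Proof.
by move=> ha; have := @whomX F 6 cw (inord a); rewrite {2}/cw inordK ?ha //; lia.
Qed.

Lemma Ux_cv b : (b < 4)%N -> whom cv 0 (Ux b).
Proof. by move=> hb; have := @whomX F 6 cv (inord (2 + b)); rewrite {2}/cv inordK //; lia. Qed.

Lemma Ux_cw b : (b < 4)%N -> whom cw 1 (Ux b).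
Proof. by move=> hb; have := @whomX F 6 cw (inord (2 + b)); rewrite {2}/cw inordK //; lia. Qed.

Lemma Wx_cv i b : (i < 3)%N -> (b < 2)%N -> whom cv 0 (Wx i b).
Proof.
move=> hi hb; rewrite /Wx; case: ifP => h; last by apply: Ux_cv; lia.
by apply/whomN/whomD; apply: Ux_cv; lia.
Qed.

Lemma Wx_cw i b : (i < 3)%N -> (b < 2)%N -> whom cw 1 (Wx i b).
Proof.
move=> hi hb; rewrite /Wx; case: ifP => h; last by apply: Ux_cw; lia.
by apply/whomN/whomD; apply: Ux_cw; lia.
Qed.

Lemma kv_dhomog i e : kv F i e \is 1.-homog.
Proof. by rewrite /kv dhomogX /= mdeg1. Qed.

Lemma zmon_dhomog m : wt cv m = wt cw m -> zmon m \is (size (vseq m)).-homog.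
Proof.
rewrite -size_vseq -size_wseq /zmon => -[].
elim: (vseq m) (wseq m) => [|a s IH] [|b t] //= => [_|[st]]; first exact: dhomog1.
exact: dhomogM (kv_dhomog _ _) (IH _ st).
Qed.

Lemma nu_dhomog d (p : S) : bal 0 p -> whom cv d%:Z p -> nu p \is d.-homog.
Proof.
move=> bp hp; rewrite /nu big_seq; apply: rpred_sum => m.
rewrite mcoeff_msupp => hm; apply: rpredZ.
have := balP bp hm; have := hp m hm => h1 /eqP; rewrite subr_eq0 => /eqP h2.
by have := zmon_dhomog h2; move: h1; rewrite -size_vseq => -[->].
Qed.

Lemma segre_cv d (p : P) : p \is d.-homog -> whom cv d%:Z (segre p).
Proof.
move/whom_dhomog; apply: whom_comp => i; rewrite tnth_mktuple -[1]addr0.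
have := ltn_ord i => hi.
by apply: whomM; [apply: Vx_cv | apply: Wx_cv]; lia.
Qed.

Lemma segre_cw d (p : P) : p \is d.-homog -> whom cw d%:Z (segre p).
Proof.
move/whom_dhomog; apply: whom_comp => i; rewrite tnth_mktuple -[1]add0r.
have := ltn_ord i => hi.
by apply: whomM; [apply: Vx_cw | apply: Wx_cw]; lia.
Qed.

(** * Rank one factorization of the Kronecker product *)

Variables (n : nat) (sigma : 'I_3 -> bool).
Notation Vec := (Vec F n).
Notation Fam := (Fam F n).
Notation inM := (@inM F n sigma).
Notation isSec := (@isSec F n sigma).
Notation homSec := (@homSec F n sigma).

(** Entry [e] of [v w_i^T] is a coordinate of [v] times one of [w_i]; the sign [s] selects which of
    the two factors is meant. *)
Definition xi (s : bool) (i e : nat) : S := if s then Vx (e %/ 2) else Wx i (e %% 2).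

Definition FE (s : bool) (i j : nat) : S :=
  if s then Vx 0 ^+ (n - j) * Vx 1 ^+ j else Wx i 0 ^+ (n - j) * Wx i 1 ^+ j.

Lemma segre_xi s i e : (i < 3)%N -> (e < 4)%N ->
  segre (kv F i e) = xi s i e * xi (~~ s) i e.
Proof. by move=> hi he; rewrite segre_kv //; case: s => //=; rewrite mulrC. Qed.

Lemma xi_neq0 s i e : xi s i e != 0.
Proof. by case: s; [exact: Vx_neq0 | apply: Wx_neq0; lia]. Qed.

Lemma xi_cv (s : bool) i e : (i < 3)%N -> (e < 4)%N -> whom cv (s : nat)%:Z (xi s i e).
Proof. by case: s => hi he; [apply: Vx_cv | apply: Wx_cv] => //; lia. Qed.

Lemma xi_cw (s : bool) i e : (i < 3)%N -> (e < 4)%N -> whom cw (~~ s : nat)%:Z (xi s i e).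
Proof. by case: s => hi he; [apply: Vx_cw | apply: Wx_cw] => //; lia. Qed.

Lemma FE_xi s i j : FE s i j = xi s i 0 ^+ (n - j) * xi s i 3 ^+ j.
Proof. by case: s. Qed.

Lemma FE_cv (s : bool) i (j : 'I_n.+1) : (i < 3)%N -> whom cv (n * s)%N%:Z (FE s i j).
Proof.
move=> hi; have -> : (n * s)%N%:Z = (s : nat)%:Z * (n - j)%N%:Z + (s : nat)%:Z * j%:Z.
  by have := ltn_ord j; lia.
by rewrite FE_xi; apply: whomM; apply: whom_exp; apply: xi_cv.
Qed.

Lemma FE_cw (s : bool) i (j : 'I_n.+1) : (i < 3)%N -> whom cw (n * ~~ s)%N%:Z (FE s i j).
Proof.
move=> hi; have -> : (n * ~~ s)%N%:Z = (~~ s : nat)%:Z * (n - j)%N%:Z + (~~ s : nat)%:Z * j%:Z.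
  by have := ltn_ord j; lia.
by rewrite FE_xi; apply: whomM; apply: whom_exp; apply: xi_cw.
Qed.

Lemma FE_neq0 s i j : FE s i j != 0.
Proof. by rewrite FE_xi mulf_neq0 ?expf_neq0 ?xi_neq0. Qed.

(** On a rank one matrix both branches of [Sk] give the same monomial; the case distinction there
    only keeps exponents nonnegative. *)
Lemma segre_Sk s i (r c : 'I_n.+1) : (i < 3)%N ->
  segre (Sk F s i r c) = FE s i r * FE (~~ s) i c.
Proof.
move=> hi; have hr := ltn_ord r; have hc := ltn_ord c.
suff H (a b : nat) : (a <= n)%N -> (b <= n)%N ->
   segre (if (a + b <= n)%N then kv F i 0 ^+ (n - a - b) * kv F i 1 ^+ b * kv F i 2 ^+ a
    else kv F i 1 ^+ (n - a) * kv F i 2 ^+ (n - b) * kv F i 3 ^+ (a + b - n)) =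
   Vx 0 ^+ (n - a) * Vx 1 ^+ a * (Wx i 0 ^+ (n - b) * Wx i 1 ^+ b).
  by rewrite /Sk; case: s => /=; rewrite H //= mulrC.
move=> ha hb; case: leqP => hab; rewrite !rmorphM !rmorphXn /= !segre_kv //=.
  have -> : (n - a = (n - a - b) + b)%N by lia.
  have -> : (n - b = (n - a - b) + a)%N by lia.
  by rewrite !exprMn addnK !exprD; ring.
have [d Hd] : exists d, (a + b - n)%N = d by eexists.
rewrite Hd; have -> : Vx 1 ^+ a = Vx 1 ^+ (n - b + d) by congr (_ ^+ _); lia.
have -> : Wx i 1 ^+ b = Wx i 1 ^+ (n - a + d) by congr (_ ^+ _); lia.
by rewrite !exprMn !exprD; ring.
Qed.

Lemma Sk_dhomog s i (r c : 'I_n.+1) : Sk F s i r c \is n.-homog.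
Proof.
have hr := ltn_ord r; have hc := ltn_ord c.
have H j e : kv F i e ^+ j \is j.-homog.
  by have := dhomogMn j (kv_dhomog i e); rewrite mul1n.
have HM (p q : P) x y : p \is x.-homog -> q \is y.-homog -> (x + y = n)%N -> p * q \is n.-homog.
  by move=> hp hq <-; exact: dhomogM.
rewrite /Sk; case: ifP => h; apply: (HM _ _ _ _ (dhomogM (H _ _) (H _ _)) (H _ _)).
  by case: s h => h; lia.
by case: s h => h; lia.
Qed.

Definition ev (r : Idx n) : S :=
  FE (sigma 0) 0 r.1.1 * FE (sigma 1) 1 r.1.2 * FE (sigma 2) 2 r.2.

(** Column [c] of the Kronecker product is [kc c] times [ev], the fixed vector [e]. The signs are
    opposite to those of [ev], so the bidegree [(vd, wd)] of [ev] is swapped for [kc]. *)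
Definition kc (c : Idx n) : S :=
  FE (~~ sigma 0) 0 c.1.1 * FE (~~ sigma 1) 1 c.1.2 * FE (~~ sigma 2) 2 c.2.

Definition vd : nat := (n * (sigma 0%R + sigma 1%R + sigma 2%R))%N.
Definition wd : nat := (n * (~~ sigma 0%R + ~~ sigma 1%R + ~~ sigma 2%R))%N.

Lemma segre_Kr (r c : Idx n) : segre (Kr F sigma r c) = ev r * kc c.
Proof. by rewrite /Kr !rmorphM /= !segre_Sk // /ev /kc; ring. Qed.

Lemma Kr_dhomog (r c : Idx n) : Kr F sigma r c \is (3 * n).-homog.
Proof.
have -> : (3 * n = n + n + n)%N by lia.
by rewrite /Kr; do 2?apply: dhomogM; exact: Sk_dhomog.
Qed.

Lemma ev_neq0 r : ev r != 0.
Proof. by rewrite /ev !mulf_neq0 ?FE_neq0. Qed.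

Lemma ev_cv r : whom cv vd (ev r).
Proof.
rewrite /vd !mulnDr !PoszD; do 2?apply: whomM; exact: FE_cv.
Qed.

Lemma ev_cw r : whom cw wd (ev r).
Proof.
rewrite /wd !mulnDr !PoszD; do 2?apply: whomM; exact: FE_cw.
Qed.

Lemma kc_cv c : whom cv wd (kc c).
Proof.
rewrite /wd !mulnDr !PoszD; do 2?apply: whomM; exact: FE_cv.
Qed.

Lemma kc_cw c : whom cw vd (kc c).
Proof.
have H (s : bool) i (j : 'I_n.+1) : (i < 3)%N -> whom cw (n * s)%N (FE (~~ s) i j).
  by move=> hi; have := @FE_cw (~~ s) i j hi; rewrite negbK.
rewrite /vd !mulnDr !PoszD; do 2?apply: whomM; exact: H.
Qed.

Lemma kc_bal c : bal (wd%:Z - vd%:Z) (kc c).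
Proof. apply: whom_subw; [exact: kc_cv | exact: kc_cw]. Qed.

Definition cfs (t : CI) : S := segre (cf F t).

Lemma cfs_neq0 t : cfs t != 0.
Proof. by rewrite /cfs /cf !rmorphM /= !(segre_xi true) // !mulf_neq0 ?xi_neq0. Qed.

Lemma cfsX t e : segre (cf F t ^+ e) = cfs t ^+ e.
Proof. by rewrite rmorphXn. Qed.

Lemma cfs_bal t e : bal 0 (cfs t ^+ e).
Proof. by rewrite -cfsX; exact: bal_segre. Qed.

(** The power of [h] in the definition of equality cancels in the domain, and conversely the power 0
    already works because the ideal is the whole kernel. *)
Lemma locEqP (h : P) (x y : Vec * P) : segre h != 0 ->
  (locEq h x y <-> forall r, segre y.2 * segre (x.1 r) = segre x.2 * segre (y.1 r)).
Proof.
move=> h0; split=> [[l H] r|H].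
  have := segre_inI (H r); rewrite rmorphM rmorphXn /= rmorphB !rmorphM /=.
  by move/eqP; rewrite mulf_eq0 expf_eq0 (negPf h0) andbF /= subr_eq0 => /eqP.
exists 0%N => r; rewrite expr0 mul1r; apply: inI_ker.
by rewrite rmorphB !rmorphM /= H subrr.
Qed.

(* All elements of [M] are multiples of the one vector [ev], so a section amounts to a
   single polynomial [f], its coefficient. *)
Definition rep (s : Fam) (f : S) : Prop :=
  forall t r, segre ((s t).1 r) = f * cfs t ^+ (s t).2 * ev r.

Lemma inM_ev (v : Vec) : inM v ->
  exists2 f, bal (wd%:Z - vd%:Z) f & forall r, segre (v r) = f * ev r.
Proof.
move=> [c hc]; exists (\sum_col segre (c col) * kc col).
  apply: whom_sum => col _; rewrite -[_ - _]add0r.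
  by apply: whomM; [exact: bal_segre | exact: kc_bal].
move=> r; have /eqP := segre_inI (hc r); rewrite rmorphB /= subr_eq0 => /eqP ->.
rewrite rmorph_sum /= mulr_suml; apply: eq_bigr => col _.
by rewrite rmorphM /= segre_Kr; ring.
Qed.

Lemma inM_col (p : P) (c : Idx n) : inM (fun r => p * Kr F sigma r c).
Proof.
exists (fun c' => if c' == c then p else 0) => r.
rewrite (bigD1 c) //= eqxx big1 ?addr0 ?subrr; first exact: inI_0.
by move=> c' /negPf ->; rewrite mul0r.
Qed.

(** Extreme indices 0 or [n], chosen so that [kc] of this column is the [n]-th power of the half of
    [cfs t] complementary to the one in [cfco t]. Their product is [cfs t ^+ n], invertible on the
    chart. *)
Definition cfcol (t : CI) : Idx n :=
  (inord (n * (if sigma 0%R then t.1.1 %% 2 else t.1.1 %/ 2))%N,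
   inord (n * (if sigma 1%R then t.1.2 %% 2 else t.1.2 %/ 2))%N,
   inord (n * (if sigma 2%R then t.2 %% 2 else t.2 %/ 2))%N).

Definition cfco (t : CI) : S :=
  (xi (sigma 0) 0 t.1.1 * xi (sigma 1) 1 t.1.2 * xi (sigma 2) 2 t.2) ^+ n.

Lemma FE_col s i (e : 'I_4) :
  FE (~~ s) i (inord (n * (if s then e %% 2 else e %/ 2))%N : 'I_n.+1) = xi (~~ s) i e ^+ n.
Proof.
have he := ltn_ord e.
set b := (if s then _ else _); have hb : (b < 2)%N by rewrite /b; case: (s); lia.
rewrite inordK; last by nia.
have -> : xi (~~ s) i e = if s then Wx i b else Vx b by rewrite /xi /b; case: (s).
rewrite /FE; move: b hb => [|[|//]] _; rewrite ?muln0 ?muln1 ?subn0 ?subnn !expr0.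
  by case: (s); rewrite /= mulr1.
by case: (s); rewrite /= mul1r.
Qed.

Lemma cfs_split t : cfco t * kc (cfcol t) = cfs t ^+ n.
Proof.
rewrite /cfs /cf !rmorphM /= (segre_xi (sigma 0)) // (segre_xi (sigma 1)) //.
rewrite (segre_xi (sigma 2)) // /kc /cfcol /= !FE_col /cfco !exprMn; ring.
Qed.

Lemma cfco_cv t : whom cv vd (cfco t).
Proof.
rewrite /cfco /vd mulnC PoszM; apply: whom_exp.
by rewrite !PoszD; do 2?apply: whomM; exact: xi_cv.
Qed.

Lemma cfco_cw t : whom cw wd (cfco t).
Proof.
rewrite /cfco /wd mulnC PoszM; apply: whom_exp.
by rewrite !PoszD; do 2?apply: whomM; exact: xi_cw.
Qed.

(** The section [f * e]: on chart [t] it is a multiple of one column over [cf t ^+ n]. The factor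
    [f * cfco t] is balanced, which is why [nu] can lift it. *)
Definition secf (f : S) : Fam :=
  fun t => (fun r => nu (f * cfco t) * Kr F sigma r (cfcol t), n).

Lemma cfco_bal f t : bal (wd%:Z - vd%:Z) f -> bal 0 (f * cfco t).
Proof.
move=> bf; rewrite -(subrr (wd%:Z - vd%:Z)) opprB.
by apply: whomM => //; apply: whom_subw; [exact: cfco_cv | exact: cfco_cw].
Qed.

Lemma secf_rep f : bal (wd%:Z - vd%:Z) f -> rep (secf f) f.
Proof.
move=> bf t r; rewrite /= rmorphM /= segre_nu; last exact: cfco_bal.
by rewrite segre_Kr -cfs_split; ring.
Qed.

Lemma locEq_loc h (s s' : Fam) t t' f f' : segre h != 0 -> rep s f -> rep s' f' ->
  (locEq h (loc s t) (loc s' t') <-> f = f').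
Proof.
move=> h0 hs hs'; rewrite locEqP // /loc /= !cfsX.
split=> [/(_ (ord0, ord0, ord0))|E r]; last by rewrite hs hs' E; ring.
rewrite hs hs' => E.
have N := mulf_neq0 (mulf_neq0 (expf_neq0 (s t).2 (cfs_neq0 t))
  (expf_neq0 (s' t').2 (cfs_neq0 t'))) (ev_neq0 (ord0, ord0, ord0)).
by apply: (mulIf N); ring: E.
Qed.

Lemma secf_sec f : bal (wd%:Z - vd%:Z) f -> isSec (secf f).
Proof.
move=> bf; split=> [t|t t']; first exact: inM_col.
apply/locEq_loc; [|exact: secf_rep..|by []].
by rewrite rmorphM mulf_neq0 ?cfs_neq0.
Qed.

Lemma secf_hom f (a b : nat) (d : int) : whom cv a f -> whom cw b f ->
  d = a%:Z + vd%:Z -> d = b%:Z + wd%:Z -> homSec d (secf f).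
Proof.
move=> fa fb da db t; exists (secf f t); split; first exact: inM_col; split.
  by apply/locEqP; rewrite ?cfs_neq0.
(* The lifted factor has degree [a + vd] and the column degree [3n]; the denominator [cf t ^+ n]
   takes [3n] away again. *)
exists (a + vd + 3 * n)%N; split; first by rewrite da.
exists (secf f t).1; split=> r; first by rewrite subrr; exact: inI_0.
apply: dhomogM (Kr_dhomog _ _); apply: nu_dhomog.
  apply: cfco_bal; have -> : wd%:Z - vd%:Z = a%:Z - b%:Z by lia.
  exact: whom_subw fa fb.
by rewrite PoszD; apply: whomM => //; exact: cfco_cv.
Qed.

(** Under [segre] a form of degree [D] has degree [D] both in [v] and in [w]; dividing by [ev] and
    the denominator gives two conditions on [f], and one chart suffices since [f] is global. *)
Lemma hom_rep s f d : rep s f -> homSec d s -> whom cv (d - vd%:Z) f /\ whom cw (d - wd%:Z) f.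
Proof.
pose t0 : CI := (ord0, ord0, ord0); pose r0 : Idx n := (ord0, ord0, ord0).
move=> hs /(_ t0) [y [_ [hy [D [hD [w [hyw hw]]]]]]].
move/locEqP: hy => /(_ (cfs_neq0 _) r0); rewrite /= !cfsX hs.
have /eqP := segre_inI (hyw r0); rewrite rmorphB /= subr_eq0 => /eqP -> E.
have cfk j : cf F t0 ^+ j \is (3 * j).-homog.
  by apply: dhomogMn; rewrite /cf -[3%N]/(1 + 1 + 1)%N; do 2?apply: dhomogM; exact: kv_dhomog.
have E' : f * (cfs t0 ^+ y.2 * ev r0) = segre (w r0).
  apply: (mulIf (expf_neq0 (s t0).2 (cfs_neq0 t0))).
  by rewrite [RHS]mulrC -E; ring.
have N : cfs t0 ^+ y.2 * ev r0 != 0 by rewrite mulf_neq0 ?expf_neq0 ?cfs_neq0 ?ev_neq0.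
split; [apply: (whom_div (e := (3 * y.2)%N%:Z + vd%:Z) N)
       | apply: (whom_div (e := (3 * y.2)%N%:Z + wd%:Z) N)].
- rewrite E'; have -> : d - vd%:Z + ((3 * y.2)%N%:Z + vd%:Z) = D by lia.
  exact: segre_cv.
- by apply: whomM; [rewrite -cfsX; exact: segre_cv | exact: ev_cv].
- rewrite E'; have -> : d - wd%:Z + ((3 * y.2)%N%:Z + wd%:Z) = D by lia.
  exact: segre_cw.
- by apply: whomM; [rewrite -cfsX; exact: segre_cw | exact: ev_cw].
Qed.

(** * Descent and generators *)

Lemma In_mem (T : eqType) (x : T) s : List.In x s -> x \in s.
Proof. by elim: s => //= y s IH [->|/IH]; rewrite inE ?eqxx // => ->; rewrite orbT. Qed.

(** Variables of weight one are peeled off one at a time; while the remaining weight is nonzero,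
    such a variable must still occur. *)
Lemma mnm_split k (c : 'I_k -> int) (b : nat) (m : 'X_{1..k}) :
  (forall i, 0 <= c i <= 1) -> b%:Z <= wt c m ->
  exists m1 m2, [/\ m = (m1 + m2)%MM, wt c m2 = b & forall i, c i = 0 -> m2 i = 0%N].
Proof.
move=> c01; elim: b => [|b IH] hb.
  exists m, 0%MM; split; rewrite ?addm0 ?wt0 // => i _; exact: mnm0E.
have [|m1 [m2 [E h2 h0]]] := IH; first by lia.
have : wt c m1 != 0 by move: hb; rewrite E wtD h2; lia.
case: (boolP [exists i, (c i != 0) && (m1 i != 0%N)]) => [/existsP[i /andP[ci m1i]] _|].
  exists (m1 - U_(i))%MM, (U_(i) + m2)%MM; split.
  - by rewrite addmA submK -?E // lep1mP.
  - by rewrite wtD h2 wt1; have := c01 i; lia.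
  - move=> j cj; rewrite mnmDE h0 // mnm1E; case: eqP => // ij.
    by rewrite ij cj eqxx in ci.
rewrite negb_exists => /forallP H; rewrite /wt big1 ?eqxx // => i _.
by have := H i; rewrite negb_and !negbK => /orP[] /eqP ->; rewrite ?mul0r ?mulr0.
Qed.

Definition corner0 : CI := (ord0, ord0, ord0).
Definition corner1 : CI := (ord_max, ord_max, ord_max).

Lemma Ux_fix b (i : 'I_6) L : (2 + b < 6)%N -> (2 + b != i)%N ->
  Ux b \mPo [tuple if j == i then L else 'X_j | j < 6] = Ux b.
Proof.
move=> hb hi; rewrite /Ux comp_mpolyXU -tnth_nth tnth_mktuple.
by rewrite -val_eqE /= inordK // (negPf hi).
Qed.

Lemma Vx_fix a (i : 'I_6) L : (a < 6)%N -> (a != i)%N ->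
  Vx a \mPo [tuple if j == i then L else 'X_j | j < 6] = Vx a.
Proof.
move=> ha hi; rewrite /Vx comp_mpolyXU -tnth_nth tnth_mktuple.
by rewrite -val_eqE /= inordK // (negPf hi).
Qed.

Lemma cfs_corner0 : cfs corner0 =
  - (Vx 0 * (Vx 0 * (Vx 0 * (Ux 0 * (Ux 2 * (Ux 0 + Ux 2)))))).
Proof. by rewrite /cfs /cf !rmorphM /= !segre_kv //= /Wx /=; ring. Qed.

Lemma cfs_corner1 : cfs corner1 =
  - (Vx 1 * (Vx 1 * (Vx 1 * (Ux 1 * (Ux 3 * (Ux 1 + Ux 3)))))).
Proof. by rewrite /cfs /cf !rmorphM /= !segre_kv //= /Wx /=; ring. Qed.

(* [D(a_1 a_2 a_3)] and [D(d_1 d_2 d_3)] already cover [X^+ - Z_3] up to codimension 2. *)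
Lemma corner_coprime (f g : S) e : cfs corner0 * g = f * cfs corner1 ^+ e ->
  exists f', f = cfs corner0 * f'.
Proof.
(* [cfs corner0] involves only the variables 0, 2, 4 and [cfs corner1] only 1, 3, 5, so substituting
   for an even variable leaves the latter unchanged and nonzero. *)
have lin (i : 'I_6) (L g1 f1 : S) : ((i : nat) \in [:: 0; 2; 4])%N ->
    let t := [tuple if j == i then L else 'X_j | j < 6] in L \mPo t = L ->
    ('X_i - L) * g1 = f1 * cfs corner1 ^+ e -> exists f', f1 = ('X_i - L) * f'.
  move=> hi t Lt; apply: dvd_linear_form => //.
  suff E : cfs corner1 \mPo t = cfs corner1.
    by rewrite rmorphXn /= E expf_neq0 // cfs_neq0.
  rewrite cfs_corner1 rmorphN !rmorphM rmorphD /= !Ux_fix ?Vx_fix //;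
    by move: hi; rewrite !inE => /or3P[] /eqP ->.
have step0 (i : 'I_6) g1 f1 : ((i : nat) \in [:: 0; 2; 4])%N ->
    'X_i * g1 = f1 * cfs corner1 ^+ e -> exists f', f1 = 'X_i * f'.
  move=> hi; rewrite -[X in X * _]subr0 => E.
  have [|f' ->] := lin _ _ _ _ hi _ E; first by rewrite comp_mpoly0.
  by exists f'; rewrite subr0.
have C (h : S) (h0 : h != 0) (f1 g1 : S) : h * g1 = h * f1 * cfs corner1 ^+ e ->
    g1 = f1 * cfs corner1 ^+ e.
  by rewrite -mulrA => /(mulfI h0).
rewrite cfs_corner0 mulNr -mulrN -!mulrA => E.
have [|f1 E1] := step0 _ _ _ _ E; first by rewrite inordK.
move: E; rewrite E1 => /(C _ (Vx_neq0 _)) E.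
have [|f2 E2] := step0 _ _ _ _ E; first by rewrite inordK.
move: E; rewrite E2 => /(C _ (Vx_neq0 _)) E.
have [|f3 E3] := step0 _ _ _ _ E; first by rewrite inordK.
move: E; rewrite E3 => /(C _ (Vx_neq0 _)) E.
have [|f4 E4] := step0 _ _ _ _ E; first by rewrite inordK.
move: E; rewrite E4 => /(C _ (Ux_neq0 _)) E.
have [|f5 E5] := step0 _ _ _ _ E; first by rewrite inordK.
move: E; rewrite E5 => /(C _ (Ux_neq0 _)) E.
(* The last factor [Ux 0 + Ux 2] is put into the form ['X_i - L] with [L = - Ux 2]. *)
rewrite -[Ux 2]opprK in E.
have [||f6 E6] := lin _ _ _ _ _ _ E; first by rewrite inordK.
  by rewrite rmorphN /= Ux_fix // inordK.
exists (- f6); rewrite E6 opprK.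
by rewrite /Ux /Vx /=; ring.
Qed.

Lemma corner_coprimeX (f g : S) k e :
  cfs corner0 ^+ k * g = f * cfs corner1 ^+ e ->
  exists f', f = f' * cfs corner0 ^+ k.
Proof.
elim: k f => [|k IH] f; first by exists f; rewrite mulr1.
rewrite exprS -mulrA => E; have [f1 E1] := corner_coprime E.
move: E; rewrite E1 -mulrA => /(mulfI (cfs_neq0 corner0)) /IH[f2 ->].
by exists f2; ring.
Qed.

(** Each chart yields a fraction with numerator [ft t]. Agreement of the two corner fractions, whose
    denominators are coprime, forces a polynomial; comparison with [corner0] then identifies the
    fraction on every other chart. *)
Lemma sec_rep s : isSec s -> exists2 f, bal (wd%:Z - vd%:Z) f & rep s f.
Proof.
move=> [sM sE].
have /choice [ft Hft] : forall t, exists f, bal (wd%:Z - vd%:Z) f /\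
    forall r, segre ((s t).1 r) = f * ev r.
  by move=> t; have [f h1 h2] := inM_ev (sM t); exists f.
have comp t t' : ft t * cfs t' ^+ (s t').2 = ft t' * cfs t ^+ (s t).2.
  have h0 : segre (cf F t * cf F t') != 0 by rewrite rmorphM mulf_neq0 ?cfs_neq0.
  move/(locEqP _ _ h0): (sE t t') => /(_ (ord0, ord0, ord0)) /=.
  rewrite !cfsX (Hft t).2 (Hft t').2 => E.
  by apply: (mulIf (ev_neq0 (ord0, ord0, ord0))); ring: E.
have [f Ef] : exists f, ft corner0 = f * cfs corner0 ^+ (s corner0).2.
  apply: (@corner_coprimeX _ (ft corner1) _ (s corner1).2).
  by rewrite comp mulrC.
have c0 := expf_neq0 (s corner0).2 (cfs_neq0 corner0).
exists f => [|t r].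
  apply: (whom_div (e := 0) c0); last exact: cfs_bal.
  by rewrite addr0 -Ef; exact: (Hft _).1.
rewrite (Hft t).2; congr (_ * _); apply: (mulIf c0).
by rewrite comp Ef; ring.
Qed.

Lemma rep_secEq s s' f f' : rep s f -> rep s' f' -> (secEq s s' <-> f = f').
Proof.
move=> h h'; split=> [/(_ corner0)/(locEq_loc _ _ (cfs_neq0 _) h h') //|E t].
exact/(locEq_loc _ _ (cfs_neq0 _) h h').
Qed.

Lemma rep_fun s f f' : rep s f -> rep s f' -> f = f'.
Proof.
by move=> h h'; apply/(rep_secEq h h') => t; exact/(locEq_loc _ _ (cfs_neq0 _) h h).
Qed.

Lemma rep_sadd s s' f f' : rep s f -> rep s' f' -> rep (sadd s s') (f + f').
Proof.
move=> h h' t r; rewrite /= /vadd /vscale /= rmorphD !rmorphM /= !cfsX h h' exprD.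
ring.
Qed.

Lemma rep_sscale p s f : rep s f -> rep (sscale p s) (segre p * f).
Proof. by move=> h t r; rewrite /= /vscale rmorphM /= h !mulrA. Qed.

Lemma rep_szero : rep (szero F n) 0.
Proof. by move=> t r; rewrite /= /vzero rmorph0 !mul0r. Qed.

Lemma res_sec v : inM v -> isSec (res v).
Proof.
move=> hv; split=> [t|t t'] //.
have h0 : segre (cf F t * cf F t') != 0 by rewrite rmorphM mulf_neq0 ?cfs_neq0.
exact/(locEqP _ _ h0).
Qed.

Lemma res_inj (v : Vec) : secEq (res v) (res (@vzero F n)) -> eqVI v (@vzero F n).
Proof.
move=> /(_ corner0)/(locEqP _ _ (cfs_neq0 _)) H r.
apply: inI_ker; have := H r; rewrite /= expr0 rmorph1 !mul1r rmorphB /= => ->.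
by rewrite subrr.
Qed.

Lemma M_gen : @genM F n sigma (3 * n).
Proof.
move=> v [c hc].
exists [seq (c col, fun r => Kr F sigma r col) | col <- index_enum (Idx n)]; split.
  move=> x /List.in_map_iff[col [<- _]]; split.
    have [c' hc'] := inM_col 1 col; exists c' => r.
    by have := hc' r; rewrite mul1r.
  exists (fun r => Kr F sigma r col); split=> r; last exact: Kr_dhomog.
  by rewrite subrr; exact: inI_0.
move=> r; have := hc r; congr (inI (_ - _)).
elim: (index_enum _) => [|col l IH]; first by rewrite big_nil.
by rewrite big_cons /= /vadd /vscale -IH.
Qed.

(* [(a, b)] is the bidegree in [(v, w)] of the coefficients of [ev] in the generators. *)
Lemma sec_gen (a b : nat) (d : int) : (a == 0)%N || (b == 0)%N ->
  d = a%:Z + vd%:Z -> d = b%:Z + wd%:Z -> @genSec F n sigma d.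
Proof.
move=> ab da db s hs; have [f bf hf] := sec_rep hs.
(* In [m] the degree in [v] exceeds that in [w] by [a - b]. As [a] or [b] is 0, the kind of variable
   in excess is plentiful enough to split off bidegree [(a, b)], leaving a balanced monomial, which
   lifts to the ring. *)
have split_mon m : m \in msupp f -> exists m1 : 'X_{1..6} * 'X_{1..6},
    [/\ m = (m1.1 + m1.2)%MM, wt cv m1.1 = wt cw m1.1,
        wt cv m1.2 = a & wt cw m1.2 = b].
  rewrite mcoeff_msupp => /(balP bf) E.
  have split01 (c c' : 'I_6 -> int) k : (forall i, c i = 0 \/ c' i = 0) ->
      (forall i, c i = 0 \/ c i = 1) -> wt c m >= k%:Z -> exists m1 m2 : 'X_{1..6},
      [/\ m = (m1 + m2)%MM, wt c m2 = k & wt c' m2 = 0].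
    move=> hcc' hc01 hk; have [|m1 [m2 [h1 h2 h3]]] := @mnm_split _ c k m _ hk.
      by move=> i; have [-> | ->] := hc01 i.
    exists m1, m2; split=> //; rewrite /wt big1 // => i _.
    have [h|->] := hcc' i; last by rewrite mul0r.
    by rewrite h3 ?h // mulr0.
  have W0 c : (forall i, 0 <= c i) -> 0 <= wt c m.
    by move=> hc; apply: sumr_ge0 => i _; apply: mulr_ge0.
  have Wv := W0 cv; have Ww := W0 cw.
  have {}Wv : 0 <= wt cv m by apply: Wv => i; rewrite /cv; case: ifP.
  have {}Ww : 0 <= wt cw m by apply: Ww => i; rewrite /cw; case: ifP.
  case/orP: ab => /eqP ab.
    have [|||m1 [m2 [h1 h2 h3]]] := split01 cw cv b.
    - by move=> i; rewrite /cv /cw; case: ifP; auto.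
    - by move=> i; rewrite /cw; case: ifP; auto.
    - lia.
    exists (m1, m2); split=> //=; last by rewrite h3 ab.
    by move: E; rewrite h1 !wtD h2 h3; lia.
  have [|||m1 [m2 [h1 h2 h3]]] := split01 cv cw a.
  - by move=> i; rewrite /cv /cw; case: ifP; auto.
  - by move=> i; rewrite /cv; case: ifP; auto.
  - lia.
  exists (m1, m2); split=> //=; last by rewrite h3 ab.
  by move: E; rewrite h1 !wtD h2 h3; lia.
pose z : 'X_{1..6} * 'X_{1..6} := (0%MM, 0%MM).
have /choice [g hg] : forall m, exists m1 : 'X_{1..6} * 'X_{1..6}, m \in msupp f ->
    [/\ m = (m1.1 + m1.2)%MM, wt cv m1.1 = wt cw m1.1,
        wt cv m1.2 = a & wt cw m1.2 = b].
  move=> m; case: (boolP (m \in msupp f)) => [/split_mon[m1 h]|_]; first by exists m1.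
  by exists z.
exists [seq (f@_m *: zmon (g m).1, secf 'X_[(g m).2]) | m <- msupp f].
have hm m : m \in msupp f -> whom cv a%:Z ('X_[(g m).2] : S) /\ whom cw b%:Z ('X_[(g m).2] : S).
  by move=> /hg[_ _ <- <-]; split; exact: whomXm.
have hb m : m \in msupp f -> bal (wd%:Z - vd%:Z) ('X_[(g m).2] : S).
  move=> mf; have [h1 h2] := hm m mf; have -> : wd%:Z - vd%:Z = a%:Z - b%:Z by lia.
  by apply: whom_subw.
split.
  move=> x /List.in_map_iff[m [<- /In_mem hm']] /=.
  have [h1 h2] := hm m hm'; split; first exact/secf_sec/hb.
  exact: secf_hom h1 h2 da db.
apply/(rep_secEq hf (f' := f)) => //.
rewrite [X in rep _ X]mpolyE.
suff H l : {subset l <= msupp f} -> rep (foldr (fun x acc => sadd (sscale x.1 x.2) acc)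
    (szero F n) [seq (f@_m *: zmon (g m).1, secf 'X_[(g m).2]) | m <- l])
    (\sum_(m <- l) f@_m *: 'X_[m]) by exact: H.
elim: l => [|m l IH] hl; first by rewrite big_nil; exact: rep_szero.
have ml : m \in msupp f by apply: hl; exact: mem_head.
rewrite big_cons /=; apply: rep_sadd; last first.
  by apply: IH => x xl; apply: hl; rewrite inE xl orbT.
have [Em E _ _] := hg m ml; rewrite [X in _ *: 'X_[X]]Em.
rewrite mpolyXD scalerAl -(segre_zmon E) -segreZ; apply: rep_sscale.
exact/secf_rep/hb.
Qed.

(** * The Lorentz action *)

Lemma i2_0 : i2 0 = ord0.
Proof. by apply: val_inj; rewrite /= inordK. Qed.

Lemma i2_1 : i2 1 = ord_max.
Proof. by apply: val_inj; rewrite /= inordK. Qed.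

Lemma big_I2 (R : nmodType) (G : 'I_2 -> R) : \sum_(u < 2) G u = G ord0 + G ord_max.
Proof. by rewrite big_ord_recl big_ord1; congr (_ + G _); apply: val_inj. Qed.

Lemma SL2_unit (A : 'M[F]_2) : SL2 A -> A \in unitmx.
Proof. by rewrite unitmxE /SL2 => ->; exact: unitr1. Qed.

Lemma mulmxV2 (A : 'M[F]_2) i j : A \in unitmx ->
  A i ord0 * invmx A ord0 j + A i ord_max * invmx A ord_max j = (i == j)%:R.
Proof. by move=> /mulmxV/matrixP/(_ i j); rewrite !mxE big_I2. Qed.

Lemma mulVmx2 (A : 'M[F]_2) i j : A \in unitmx ->
  invmx A i ord0 * A ord0 j + invmx A i ord_max * A ord_max j = (i == j)%:R.
Proof. by move=> /mulVmx/matrixP/(_ i j); rewrite !mxE big_I2. Qed.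

Lemma SL2_det (A : 'M[F]_2) : SL2 A ->
  A ord0 ord0 * A ord_max ord_max - A ord0 ord_max * A ord_max ord0 = 1.
Proof.
rewrite /SL2 => <-; rewrite (expand_det_row _ ord0) big_I2 /cofactor !det_mx11 !mxE /=.
rewrite (_ : lift ord0 0 = ord_max); last exact: val_inj.
rewrite (_ : lift ord_max 0 = ord0); last exact: val_inj.
by rewrite /= expr0 expr1; ring.
Qed.

Lemma SL2_inv (A : 'M[F]_2) : SL2 A ->
  [/\ invmx A ord0 ord0 = A ord_max ord_max, invmx A ord0 ord_max = - A ord0 ord_max,
      invmx A ord_max ord0 = - A ord_max ord0 & invmx A ord_max ord_max = A ord0 ord0].
Proof.
move=> hA; have D := SL2_det hA; have M i j := mulmxV2 i j (SL2_unit hA).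
have M00 := M ord0 ord0; have M01 := M ord0 ord_max.
have M10 := M ord_max ord0; have M11 := M ord_max ord_max.
move: D M00 M01 M10 M11; rewrite /= ?eqxx /=; move: (invmx A) => I D M00 M01 M10 M11.
split.
- transitivity (
    A ord_max ord_max * (A ord0 ord0 * I ord0 ord0 + A ord0 ord_max * I ord_max ord0)
    - A ord0 ord_max * (A ord_max ord0 * I ord0 ord0 + A ord_max ord_max * I ord_max ord0)).
    by rewrite -[LHS]mul1r -D; ring.
  by rewrite M00 M10; ring.
- transitivity (
    A ord_max ord_max * (A ord0 ord0 * I ord0 ord_max + A ord0 ord_max * I ord_max ord_max)
    - A ord0 ord_max * (A ord_max ord0 * I ord0 ord_max + A ord_max ord_max * I ord_max ord_max)).
    by rewrite -[LHS]mul1r -D; ring.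
  by rewrite M01 M11; ring.
- transitivity (
    A ord0 ord0 * (A ord_max ord0 * I ord0 ord0 + A ord_max ord_max * I ord_max ord0)
    - A ord_max ord0 * (A ord0 ord0 * I ord0 ord0 + A ord0 ord_max * I ord_max ord0)).
    by rewrite -[LHS]mul1r -D; ring.
  by rewrite M00 M10; ring.
- transitivity (
    A ord0 ord0 * (A ord_max ord0 * I ord0 ord_max + A ord_max ord_max * I ord_max ord_max)
    - A ord_max ord0 * (A ord0 ord0 * I ord0 ord_max + A ord0 ord_max * I ord_max ord_max)).
    by rewrite -[LHS]mul1r -D; ring.
  by rewrite M01 M11; ring.
Qed.

(** The substitution [v -> A^-1 v], [w_i -> B^-1 w_i], which induces [k_i -> A^-1 k_i B^-T] and so
    lifts [actP] through [segre]. *)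
Definition galpha (A B : 'M[F]_2) : 6.-tuple S :=
  [tuple if (j < 2)%N
         then invmx A (i2 j) ord0 *: Vx 0 + invmx A (i2 j) ord_max *: Vx 1
         else invmx B (i2 (j %% 2)) ord0 *: Ux (2 * ((j - 2) %/ 2)) +
              invmx B (i2 (j %% 2)) ord_max *: Ux (2 * ((j - 2) %/ 2) + 1) | j < 6].

Definition alpha (A B : 'M[F]_2) (p : S) : S := p \mPo galpha A B.

HB.instance Definition _ A B := GRing.RMorphism.copy (alpha A B) (comp_mpoly (galpha A B)).

Lemma alphaZ A B c p : alpha A B (c *: p) = c *: alpha A B p.
Proof. exact: comp_mpolyZ. Qed.

Lemma alpha_Vx A B a : (a < 2)%N ->
  alpha A B (Vx a) = invmx A (i2 a) ord0 *: Vx 0 + invmx A (i2 a) ord_max *: Vx 1.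
Proof.
move=> ha; rewrite /alpha comp_mpolyXU -tnth_nth tnth_mktuple inordK ?ha //.
by lia.
Qed.

Lemma alpha_Ux A B i b : (i < 2)%N -> (b < 2)%N ->
  alpha A B (Ux (2 * i + b)) =
  invmx B (i2 b) ord0 *: Ux (2 * i) + invmx B (i2 b) ord_max *: Ux (2 * i + 1).
Proof.
move=> hi hb; rewrite /alpha comp_mpolyXU -tnth_nth tnth_mktuple inordK; last by lia.
have -> : (2 + (2 * i + b) < 2)%N = false by lia.
have -> : ((2 + (2 * i + b)) %% 2 = b)%N by lia.
by have -> : (2 * ((2 + (2 * i + b) - 2) %/ 2) = 2 * i)%N by lia.
Qed.

Lemma alpha_Wx A B i b : (i < 3)%N -> (b < 2)%N ->
  alpha A B (Wx i b) = invmx B (i2 b) ord0 *: Wx i 0 + invmx B (i2 b) ord_max *: Wx i 1.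
Proof.
move=> hi hb; rewrite /Wx; case: ifP => h; last by rewrite alpha_Ux ?addn0 //; lia.
rewrite rmorphN rmorphD /= (@alpha_Ux _ _ 0) // (@alpha_Ux _ _ 1) // muln1 muln0.
by rewrite !scalerN -opprD !scalerDr ?addn0 ?add0n addrACA.
Qed.

Lemma segre_actP A B p : segre (actP A B p) = alpha A B (segre p).
Proof.
rewrite /segre /actP /alpha !comp_mpoly_comp; congr (p \mPo _).
apply: eq_from_tnth => j; rewrite !tnth_mktuple -/(segre _) -/(alpha _ _ _).
have hj := ltn_ord j.
rewrite rmorphM /= alpha_Vx ?alpha_Wx; [|by lia..].
rewrite /substL !big_I2 !(rmorphD, segreZ) /= !segreZ !segre_kv; [|by lia..].
rewrite /= -!mul_mpolyC !mpolyCM; ring.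
Qed.

Lemma alphaK A B p : A \in unitmx -> B \in unitmx ->
  alpha (invmx A) (invmx B) (alpha A B p) = p.
Proof.
move=> hA hB; rewrite /alpha comp_mpoly_comp -[RHS]comp_mpoly_id; congr (p \mPo _).
apply: eq_from_tnth => j; rewrite !tnth_mktuple -/(alpha _ _ _).
have H (M : 'M[F]_2) (x0 x1 : S) a : M \in unitmx -> (a < 2)%N ->
    invmx M (i2 a) ord0 *: (M ord0 ord0 *: x0 + M ord0 ord_max *: x1) +
    invmx M (i2 a) ord_max *: (M ord_max ord0 *: x0 + M ord_max ord_max *: x1) =
    if a == 0%N then x0 else x1.
  move=> hM ha; rewrite !scalerDr !scalerA addrACA -!scalerDl !mulVmx2 //.
  move: a ha => [|[|//]] _; rewrite ?i2_0 ?i2_1 /=.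
    by rewrite scale1r scale0r addr0.
  by rewrite scale0r scale1r add0r.
have hj := ltn_ord j; case: ifP => h.
  rewrite rmorphD /= !alphaZ !alpha_Vx // !invmxK !i2_0 !i2_1 H //.
  by rewrite /Vx; case: eqP => jj; congr 'X_(_); apply: val_inj; rewrite /= inordK //; lia.
rewrite rmorphD /= !alphaZ alpha_Ux //; last by lia.
have := @alpha_Ux (invmx A) (invmx B) ((j - 2) %/ 2) 0; rewrite addn0 => ->//; last by lia.
rewrite !invmxK !i2_0 !i2_1 H //; last by lia.
by rewrite /Ux; case: eqP => jj; congr 'X_(_); apply: val_inj; rewrite /= inordK //; lia.
Qed.

Lemma alpha_neq0 A B p : A \in unitmx -> B \in unitmx -> p != 0 -> alpha A B p != 0.
Proof.
move=> hA hB; apply: contraNneq => /(congr1 (alpha (invmx A) (invmx B))).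
by rewrite alphaK // rmorph0 => ->.
Qed.

(** * Symmetric powers as substitutions in binary forms *)

Section Homogenization.

Variables y0 y1 : S.

(** [symA] is read off from a univariate polynomial, in which ['X] stands for the ratio [y0 / y1];
    this restores the binary form of degree [N]. *)
Definition hzn (N : nat) (p : {poly F}) : S :=
  \sum_(k < N.+1) p`_k *: (y0 ^+ k * y1 ^+ (N - k)).

Lemma hzn_mul (a b : F) N (p : {poly F}) : (size p <= N.+1)%N ->
  hzn N.+1 ((a *: 'X + b%:P) * p) = (a *: y0 + b *: y1) * hzn N p.
Proof.
move=> sp; rewrite /hzn mulrDl mulr_sumr.
under eq_bigr do rewrite coefD mul_polyC coefZ -scalerAl coefZ coefXM scalerDl.
rewrite big_split /= big_ord_recl /= mulr0 scale0r add0r [X in _ + X]big_ord_recr /=.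
rewrite [p`_N.+1]nth_default // mulr0 scale0r addr0 -!big_split /=.
apply: eq_bigr => k _; rewrite /bump /= add1n subSS.
rewrite subSn -1?ltnS // !exprS -!mul_mpolyC !mpolyCM; ring.
Qed.

Lemma hzn_lin (a b a' b' : F) k j :
  hzn (k + j) ((a *: 'X + b%:P) ^+ k * (a' *: 'X + b'%:P) ^+ j) =
    (a *: y0 + b *: y1) ^+ k * (a' *: y0 + b' *: y1) ^+ j.
Proof.
have sl (u v : F) (p : {poly F}) N : (size p <= N)%N -> (size ((u *: 'X + v%:P) * p)%R <= N.+1)%N.
  move=> hp; apply: leq_trans (size_polyMleq _ _) _.
  have : (size (u *: 'X + v%:P)%R <= 2)%N.
    apply: leq_trans (size_polyD _ _) _; rewrite geq_max.
    rewrite (leq_trans (size_scale_leq _ _)) ?size_polyX //=.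
    by rewrite (leq_trans (size_polyC_leq1 _)).
  by lia.
have sz2 i : (size ((a' *: 'X + b'%:P) ^+ i)%R <= i.+1)%N.
  by elim: i => [|i IH]; rewrite ?expr0 ?size_poly1 // exprS sl.
have sz i : (size ((a *: 'X + b%:P) ^+ i * (a' *: 'X + b'%:P) ^+ j)%R <= (i + j).+1)%N.
  by elim: i => [|i IH]; rewrite ?expr0 ?mul1r ?sz2 // exprS -mulrA sl.
elim: k => [|k IH]; last by rewrite addSn !exprS -mulrA hzn_mul ?sz // IH mulrA.
rewrite !expr0 !mul1r add0n; elim: j {sz} => [|j IH].
  by rewrite /hzn big_ord1 !expr0 coef1 scale1r mulr1.
by rewrite !exprS hzn_mul ?sz2 // IH.
Qed.

Lemma symA_sum (A : 'M[F]_2) (i : 'I_n.+1) :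
  \sum_(l < n.+1) symA A i l *: (y0 ^+ (n - l) * y1 ^+ l) =
  (A ord0 ord0 *: y0 + A ord0 ord_max *: y1) ^+ (n - i) *
  (A ord_max ord0 *: y0 + A ord_max ord_max *: y1) ^+ i.
Proof.
have hi : (n - i + i = n)%N by have := ltn_ord i; lia.
rewrite -hzn_lin hi /hzn (reindex_inj rev_ord_inj) /=; apply: eq_bigr => l _.
have hl : (l <= n)%N by rewrite -ltnS.
by rewrite /symA /= subSS subKn.
Qed.

End Homogenization.

Lemma alpha_lin A B (x : nat -> S) (M : 'M[F]_2) : M \in unitmx ->
  (forall a, (a < 2)%N -> alpha A B (x a) =
     invmx M (i2 a) ord0 *: x 0%N + invmx M (i2 a) ord_max *: x 1%N) ->
  M ord0 ord0 *: alpha A B (x 0%N) + M ord0 ord_max *: alpha A B (x 1%N) = x 0%N /\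
  M ord_max ord0 *: alpha A B (x 0%N) + M ord_max ord_max *: alpha A B (x 1%N) = x 1%N.
Proof.
move=> hM H; rewrite !H // i2_0 i2_1 !scalerDr !scalerA.
split; rewrite addrACA -!scalerDl !mulmxV2 //= ?eqxx.
  by rewrite scale1r scale0r addr0.
by rewrite scale0r scale1r add0r.
Qed.

Lemma FE_equiv A B s i (r : 'I_n.+1) : A \in unitmx -> B \in unitmx -> (i < 3)%N ->
  \sum_(c < n.+1) (if s then symA A else symA B) r c *: alpha A B (FE s i c) = FE s i r.
Proof.
move=> hA hB hi; case: s; rewrite /FE /=.
  have [E0 E1] := alpha_lin hA (@alpha_Vx A B).
  have := symA_sum (alpha A B (Vx 0)) (alpha A B (Vx 1)) A r.
  rewrite E0 E1 => <-; apply: eq_bigr => c _.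
  by rewrite rmorphM !rmorphXn.
have [E0 E1] := alpha_lin hB (fun b => @alpha_Wx A B i b hi).
have := symA_sum (alpha A B (Wx i 0)) (alpha A B (Wx i 1)) B r.
rewrite E0 E1 => <-; apply: eq_bigr => c _.
by rewrite rmorphM !rmorphXn.
Qed.

(** The matrix [rho] undoes the substitution of inverses in the Veronese vectors, so [e] is fixed by
    the group, and [f * e] is sent to [alpha A B f * e]. *)
Lemma ev_equiv A B r : A \in unitmx -> B \in unitmx ->
  \sum_c rho sigma A B r c *: alpha A B (ev c) = ev r.
Proof.
move=> hA hB; rewrite /ev.
rewrite -(FE_equiv (sigma 0) r.1.1 hA hB (i := 0)) //.
rewrite -(FE_equiv (sigma 1) r.1.2 hA hB (i := 1)) //.
rewrite -(FE_equiv (sigma 2) r.2 hA hB (i := 2)) //.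
rewrite big_distrlr /= pair_bigA /= big_distrlr /= pair_bigA /=.
apply: eq_bigr => c _; rewrite !rmorphM /= /rho /rhoF -!mul_mpolyC !mpolyCM; ring.
Qed.

Lemma rep_act A B s s' f f' : A \in unitmx -> B \in unitmx -> rep s f -> rep s' f' ->
  actRel sigma A B s s' -> f' = alpha A B f.
Proof.
move=> hA hB hs hs' [_ /(_ corner0 corner0)]; set t := corner0.
have a0 := alpha_neq0 hA hB (cfs_neq0 t).
have h0 : segre (cf F t * actP A B (cf F t)) != 0.
  by rewrite rmorphM /= segre_actP mulf_neq0 ?cfs_neq0.
move/(locEqP _ _ h0) => /(_ (ord0, ord0, ord0)) /=.
set r := (ord0, ord0, ord0).
have -> : segre (actV sigma A B (s t).1 r) =
    alpha A B f * alpha A B (cfs t) ^+ (s t).2 * ev r.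
  rewrite -(ev_equiv r hA hB) rmorph_sum mulr_sumr; apply: eq_bigr => c _.
  by rewrite /= segreZ segre_actP hs !rmorphM rmorphXn /= -scalerAr.
rewrite hs' !rmorphXn /= segre_actP -/(cfs t) => E.
have N := mulf_neq0 (mulf_neq0 (expf_neq0 (s' t).2 (cfs_neq0 t))
  (expf_neq0 (s t).2 a0)) (ev_neq0 r).
by apply: (mulIf N); ring: E.
Qed.

(** * The lowest degree part *)

(** The isomorphism must be a total function on families, so the coefficient is selected
    classically, with 0 as the value when there is none. *)
Definition secpoly (s : Fam) : S :=
  if pselect (exists f, rep s f) is left e then projT1 (cid e) else 0.

Lemma secpoly_rep s f : rep s f -> secpoly s = f.
Proof.
move=> hf; rewrite /secpoly; case: pselect => [e|[]]; last by exists f.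
exact: rep_fun (projT2 (cid e)) hf.
Qed.

Lemma rep_secpoly s : isSec s -> rep s (secpoly s).
Proof. by move=> /sec_rep[f _ hf]; rewrite (secpoly_rep hf). Qed.

(* [T] and [T'] are the mutually inverse identifications of the bidegree [(a, b)] part of
   the coordinate ring of [v, w_1, w_2] with the degree [n] polynomials in [m] variables. *)
Lemma repIso_subst m (T : 6.-tuple {mpoly F[m]}) (T' : m.-tuple S) (a b : nat) (d : int)
    (act : 'M[F]_2 -> 'M[F]_2 -> 'M[F]_m) :
  let bideg f := whom cv a%:Z f /\ whom cw b%:Z f in
  d = a%:Z + vd%:Z -> d = b%:Z + wd%:Z ->
  (forall f, bideg f -> f \mPo T \is n.-homog) ->
  (forall f, bideg f -> (f \mPo T) \mPo T' = f) ->
  (forall p, p \is n.-homog -> bideg (p \mPo T')) ->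
  (forall p, (p \mPo T') \mPo T = p) ->
  (forall A B f, SL2 A -> SL2 B -> alpha A B f \mPo T = actW (act A B) (f \mPo T)) ->
  @repIso F n sigma d m act.
Proof.
move=> bideg da db hT TK hT' T'K hact.
have hbi s : isSec s -> homSec d s -> bideg (secpoly s).
  move=> hs hd; have := hom_rep (rep_secpoly hs) hd.
  have -> : d - vd%:Z = a by lia.
  by have -> : d - wd%:Z = b by lia.
exists (fun s => secpoly s \mPo T); split.
- by move=> s hs hd; exact/hT/hbi.
- move=> s s' hs hd hs' hd'; split.
    by move/(rep_secEq (rep_secpoly hs) (rep_secpoly hs')) => ->.
  move/(congr1 (fun p => p \mPo T')); rewrite !TK; [|exact: hbi..].
  by move/(rep_secEq (rep_secpoly hs) (rep_secpoly hs')).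
- move=> x y s s' hs hd hs' hd'.
  have h := rep_sadd (rep_sscale x%:MP (rep_secpoly hs)) (rep_sscale y%:MP (rep_secpoly hs')).
  rewrite (secpoly_rep h) /segre !comp_mpolyC !mul_mpolyC.
  by rewrite comp_mpolyD !comp_mpolyZ.
- move=> p hp; have [h1 h2] := hT' p hp.
  have bf : bal (wd%:Z - vd%:Z) (p \mPo T').
    have -> : wd%:Z - vd%:Z = a%:Z - b%:Z by lia.
    exact: whom_subw h1 h2.
  exists (secf (p \mPo T')); split; first exact: secf_sec.
    exact: secf_hom h1 h2 da db.
  by rewrite (secpoly_rep (secf_rep bf)).
- move=> A B s s' hA hB hs hd hr; rewrite -hact //; congr (_ \mPo _).
  have hs' : isSec s' by case: hr.
  by apply: (rep_act (SL2_unit hA) (SL2_unit hB) (rep_secpoly hs) (rep_secpoly hs') hr).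
Qed.

(** Variables absent from [p] may be sent anywhere. This is needed because the identifications below
    kill the variables of the kind that does not occur in the given bidegree. *)
Lemma comp_mpoly_fix k (t : k.-tuple {mpoly F[k]}) (p : {mpoly F[k]}) :
  (forall m i, p@_m != 0 -> tnth t i = 'X_i \/ m i = 0%N) -> p \mPo t = p.
Proof.
move=> h; rewrite comp_mpolyEX [RHS]mpolyE big_seq [RHS]big_seq.
apply: eq_bigr => m; rewrite mcoeff_msupp => hm; congr (_ *: _).
rewrite comp_mpolyX [RHS]mpolyXE_id; apply: eq_bigr => i _.
by have [->|->] := h m i hm.
Qed.

Lemma whom0_var (c : 'I_6 -> int) (p : S) m i : (forall j, 0 <= c j) ->
  whom c 0 p -> p@_m != 0 -> c i = 1 -> m i = 0%N.
Proof.
move=> c0 hp /hp hm ci.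
have /psumr_eq0P/(_ hm i isT) : forall j, true -> 0 <= c j * (m j)%:Z.
  by move=> j _; apply: mulr_ge0.
by rewrite ci mul1r => -[].
Qed.

(* In both cases the coordinates of a copy of [C^2] are matched with the dual basis through
   the invariant symplectic form, because functions carry the contragredient action. *)
Lemma repIso_two : (sigma 0%R + sigma 1%R + sigma 2%R = 2)%N ->
  @repIso F n sigma (2 * n)%N%:Z 4 (fun _ B : 'M[F]_2 => gB2 B).
Proof.
move=> h2; have hvd : vd = (2 * n)%N by rewrite /vd h2 mulnC.
have hwd : wd = n.
  by rewrite /wd; move: h2; case: (sigma 0); case: (sigma 1); case: (sigma 2) => //=; lia.
(* The coordinates of each of [w_1], [w_2] go to [(e_1, - e_0)] in the corresponding block. *)
pose T : 6.-tuple {mpoly F[4]} := [tuple if (j < 2)%N then 0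
  else if odd j then - 'X_(inord (j - 3)) else 'X_(inord (j - 1)) | j < 6].
pose T' : 4.-tuple S :=
  [tuple if odd j then Ux (j - 1) else - Ux (j + 1) | j < 4].
apply: (@repIso_subst 4 T T' 0 n).
- by rewrite hvd.
- by rewrite hwd; lia.
- move=> f [_ hf]; apply/whom_dhomog; apply: whom_comp hf => i.
  rewrite tnth_mktuple /cw; case: ifP => _; first exact: whom0.
  by case: ifP => _; [apply: whomN|]; exact: (@whomX F 4 (fun=> 1)).
- move=> f [hf _]; rewrite comp_mpoly_comp; apply: comp_mpoly_fix => m i hm.
  rewrite !tnth_mktuple; have hi := ltn_ord i.
  case: ifP => h; [right | left].
    by apply: (whom0_var _ hf hm); rewrite /cv ?h // => j; case: ifP.
  case: ifP => o; rewrite ?rmorphN /= comp_mpolyXU -tnth_nth tnth_mktuple inordK; try lia.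
    have -> : odd (i - 3) = false by lia.
    rewrite opprK /Ux; congr 'X_(_); apply: val_inj; rewrite /= inordK; lia.
  have -> : odd (i - 1) by lia.
  rewrite /Ux; congr 'X_(_); apply: val_inj; rewrite /= inordK; lia.
- move=> p /whom_dhomog hp; split.
    apply: (whom_comp (c := fun=> 0)) => [i|m _]; last first.
      by rewrite /wt big1 // => i _; rewrite mul0r.
    rewrite tnth_mktuple; have hi := ltn_ord i.
    by case: ifP => o; [|apply: whomN]; apply: Ux_cv; lia.
  apply: whom_comp hp => i; rewrite tnth_mktuple; have hi := ltn_ord i.
  by case: ifP => o; [|apply: whomN]; apply: Ux_cw; lia.
- move=> p; rewrite comp_mpoly_comp; apply: comp_mpoly_fix => m i _; left.
  rewrite !tnth_mktuple; have hi := ltn_ord i.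
  case: ifP => o; rewrite ?rmorphN /= comp_mpolyXU -tnth_nth tnth_mktuple inordK; try lia.
    have -> : (2 + (i - 1) < 2)%N = false by lia.
    have -> : odd (2 + (i - 1)) = false by lia.
    congr 'X_(_); apply: val_inj; rewrite /= inordK; lia.
  have -> : (2 + (i + 1) < 2)%N = false by lia.
  have -> : odd (2 + (i + 1)) by lia.
  rewrite opprK; congr 'X_(_); apply: val_inj; rewrite /= inordK; lia.
- move=> A B f hA hB; rewrite /alpha /actW !comp_mpoly_comp; congr (_ \mPo _).
  apply: eq_from_tnth => j; rewrite !tnth_mktuple.
  (* For determinant one the inverse is the adjugate; with the sign in [T] a row of [B^-1] acting on
     the [w]-coordinates becomes a column of [B] acting on basis vectors. *)
  have [I00 I01 I10 I11] := SL2_inv hB.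
  have TU b : (b < 4)%N -> Ux b \mPo T = if odd b then - 'X_(inord (b - 1)) else 'X_(inord (b + 1)).
    move=> hb; rewrite comp_mpolyXU -tnth_nth tnth_mktuple inordK; last by lia.
    have -> : (2 + b < 2)%N = false by lia.
    rewrite oddD /=; case: ifP => o.
      by have -> : (2 + b - 3 = b - 1)%N by lia.
    by have -> : (2 + b - 1 = b + 1)%N by lia.
  have TV a : (a < 2)%N -> Vx a \mPo T = 0.
    by move=> ha; rewrite comp_mpolyXU -tnth_nth tnth_mktuple inordK ?ha //; lia.
  have hj := ltn_ord j; case: ifP => h.
    by rewrite comp_mpolyD !comp_mpolyZ !TV // !scaler0 addr0 comp_mpoly0.
  have X i c : (i < 2)%N -> (c < 2)%N ->
      'X_(inord (2 * i + c)) \mPo [tuple \sum_(i0 < 4) gB2 B i0 j0 *: 'X_i0 | j0 < 4] =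
      B ord0 (i2 c) *: 'X_(inord (2 * i)) + B ord_max (i2 c) *: 'X_(inord (2 * i + 1))
      :> {mpoly F[4]}.
    move=> hi hc; rewrite comp_mpolyXU -tnth_nth tnth_mktuple.
    rewrite (bigD1 (inord (2 * i))) //= (bigD1 (inord (2 * i + 1))) /=; last first.
      by rewrite -val_eqE /= !inordK; lia.
    rewrite big1 ?addr0 => [|k /andP[]]; last first.
      rewrite -!val_eqE /= !inordK; try lia.
      move=> k0 k1; rewrite !mxE inordK; last by lia.
      have -> : (k %/ 2 == (2 * i + c) %/ 2)%N = false by have := ltn_ord k; lia.
      by rewrite scale0r.
    rewrite !mxE !inordK; try lia.
    have -> : (2 * i %/ 2 == (2 * i + c) %/ 2)%N by lia.
    have -> : ((2 * i + 1) %/ 2 == (2 * i + c) %/ 2)%N by lia.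
    have -> : (2 * i %% 2 = 0)%N by lia.
    have -> : ((2 * i + 1) %% 2 = 1)%N by lia.
    have -> : ((2 * i + c) %% 2 = c)%N by lia.
    by rewrite i2_0 i2_1.
  have [i [e [hi he ->]]] : exists i e, [/\ (i < 2)%N, (e < 2)%N & (j : nat) = (2 + (2 * i + e))%N].
    by exists ((j - 2) %/ 2)%N, (j %% 2)%N; split; lia.
  have -> : ((2 + (2 * i + e)) %% 2 = e)%N by lia.
  have -> : ((2 + (2 * i + e) - 2) %/ 2 = i)%N by lia.
  rewrite comp_mpolyD !comp_mpolyZ !TU; [|lia..].
  have -> : odd (2 * i) = false by lia.
  have -> : odd (2 * i + 1) by lia.
  rewrite addnK; move: e he => [|[|//]] _.
    have -> : odd (2 + (2 * i + 0)) = false by lia.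
    have -> : (2 + (2 * i + 0) - 1 = 2 * i + 1)%N by lia.
    by rewrite X // i2_0 i2_1 I00 I01 scalerN scaleNr opprK addrC.
  have -> : odd (2 + (2 * i + 1)) by lia.
  have -> : (2 + (2 * i + 1) - 3 = 2 * i + 0)%N by lia.
  by rewrite comp_mpolyN X // i2_0 i2_1 I10 I11 scalerN scaleNr opprD addrC.
Qed.

(** With one plus sign [ev] has bidegree [(n, 2n)], so in degree [2n] the coefficients are forms of
    degree [n] in [v], on which only [A] acts. *)
Lemma repIso_one : (sigma 0%R + sigma 1%R + sigma 2%R = 1)%N ->
  @repIso F n sigma (2 * n)%N%:Z 2 (fun A _ : 'M[F]_2 => A).
Proof.
move=> h1; have hvd : vd = n by rewrite /vd h1 muln1.
have hwd : wd = (2 * n)%N.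
  by rewrite /wd; move: h1; case: (sigma 0); case: (sigma 1); case: (sigma 2) => //=; lia.
pose T : 6.-tuple {mpoly F[2]} := [tuple if (j < 2)%N then
  if odd j then - 'X_ord0 else 'X_ord_max else 0 | j < 6].
pose T' : 2.-tuple S := [tuple if odd j then Vx 0 else - Vx 1 | j < 2].
have TV : (Vx 0 \mPo T = 'X_ord_max) /\ (Vx 1 \mPo T = - 'X_ord0).
  by split; rewrite comp_mpolyXU -tnth_nth tnth_mktuple inordK.
have TU b : (b < 4)%N -> Ux b \mPo T = 0.
  move=> hb; rewrite comp_mpolyXU -tnth_nth tnth_mktuple inordK; last by lia.
  by have -> : (2 + b < 2)%N = false by lia.
have T'X : ('X_ord0 \mPo T' = - Vx 1) /\ ('X_ord_max \mPo T' = Vx 0).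
  by split; rewrite comp_mpolyXU -tnth_nth tnth_mktuple.
apply: (@repIso_subst 2 T T' n 0).
- by rewrite hvd; lia.
- by rewrite hwd; lia.
- move=> f [hf _]; apply/whom_dhomog; apply: whom_comp hf => i.
  rewrite tnth_mktuple /cv; case: ifP => _; last exact: whom0.
  by case: ifP => _; [apply: whomN|]; exact: (@whomX F 2 (fun=> 1)).
- move=> f [_ hf]; rewrite comp_mpoly_comp; apply: comp_mpoly_fix => m i hm.
  rewrite !tnth_mktuple; have hi := ltn_ord i.
  case: ifP => h; [left | right]; last first.
    by apply: (whom0_var _ hf hm); rewrite /cw ?h // => j; case: ifP.
  case: ifP => o; rewrite ?comp_mpolyN ?T'X.1 ?T'X.2 ?opprK /Vx;
    congr 'X_(_); apply: val_inj; rewrite /= inordK; lia.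
- move=> p /whom_dhomog hp; split; last first.
    apply: (whom_comp (c := fun=> 0)) => [i|m _]; last first.
      by rewrite /wt big1 // => i _; rewrite mul0r.
    by rewrite tnth_mktuple; case: ifP => o; [|apply: whomN]; exact: Vx_cw.
  apply: whom_comp hp => i; rewrite tnth_mktuple.
  by case: ifP => o; [|apply: whomN]; exact: Vx_cv.
- move=> p; rewrite comp_mpoly_comp; apply: comp_mpoly_fix => m i _; left.
  rewrite !tnth_mktuple; have hi := ltn_ord i.
  case: ifP => o; rewrite ?comp_mpolyN ?TV.1 ?TV.2 ?opprK; congr 'X_(_); apply: val_inj => /=; lia.
- move=> A B f hA hB; rewrite /alpha /actW !comp_mpoly_comp; congr (_ \mPo _).
  apply: eq_from_tnth => j; rewrite !tnth_mktuple.
  have [I00 I01 I10 I11] := SL2_inv hA.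
  have X k : 'X_k \mPo [tuple \sum_(i0 < 2) A i0 j0 *: 'X_i0 | j0 < 2] =
      A ord0 k *: 'X_ord0 + A ord_max k *: 'X_ord_max :> {mpoly F[2]}.
    by rewrite comp_mpolyXU -tnth_nth tnth_mktuple big_I2.
  have hj := ltn_ord j; case: ifP => h; last first.
    by rewrite comp_mpolyD !comp_mpolyZ !TU ?scaler0 ?addr0 ?comp_mpoly0 //; lia.
  rewrite comp_mpolyD !comp_mpolyZ TV.1 TV.2.
  have [->|->] : (j : nat) = 0%N \/ (j : nat) = 1%N by lia.
    by rewrite i2_0 /= X I00 I01 scalerN scaleNr opprK addrC.
  by rewrite i2_1 /= comp_mpolyN X I10 I11 scalerN scaleNr opprD addrC.
Qed.

End SegreModel.


Theorem mainTheorem18 (R : realType) (n : nat) (sigma : 'I_3 -> bool) :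
  let C := R[i] in
  let npos := #|[pred t : 'I_3 | sigma t]| in
  [/\ (* restriction induces an injection M -> ~M(X^+ - Z_3) *)
      (forall v : Vec C n, @inM C n sigma v ->
         @isSec C n sigma (@res C n v) /\
         (@secEq C n (@res C n v) (@res C n (@vzero C n)) ->
            @eqVI C n v (@vzero C n))),
      (* M is generated in degree 6h *)
      @genM C n sigma (3 * n)%N,
      (* sigma = (+,+,+) or (-,-,-): ~M(X^+ - Z_3) generated in degree 6h *)
      ((npos = 3%N \/ npos = 0%N) -> @genSec C n sigma (3 * n)%N%:Z),
      (* sigma a permutation of (+,+,-) or (+,-,-): generated in degree 4h *)
      ((npos = 2%N \/ npos = 1%N) -> @genSec C n sigma (2 * n)%N%:Z) &
      (* degree 4h part as a Lorentz representation *)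
      ((npos = 2%N -> @repIso C n sigma (2 * n)%N%:Z 4 (fun _ B => gB2 B)) /\
       (npos = 1%N -> @repIso C n sigma (2 * n)%N%:Z 2 (fun A _ => A)))].
Proof.
move=> C npos.
have hnpos : npos = (sigma 0%R + sigma 1%R + sigma 2%R)%N.
  rewrite /npos -sum1_card big_mkcond /= !big_ord_recl big_ord0 addn0 addnA.
  rewrite (_ : lift ord0 ord0 = 1%R); last exact: val_inj.
  rewrite (_ : lift ord0 (lift ord0 ord0) = 2%R); last exact: val_inj.
  by rewrite !inE; case: (sigma _); case: (sigma _); case: (sigma _).
have hvd : vd n sigma = (n * npos)%N by rewrite hnpos.
have hwd : wd n sigma = (n * (3 - npos))%N.
  rewrite /wd hnpos; congr (_ * _)%N.
  by case: (sigma 0%R); case: (sigma 1%R); case: (sigma 2%R).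
split.
- by move=> v hv; split; [exact: res_sec | exact: res_inj].
- exact: M_gen.
(* The bidegree passed to [sec_gen] is [(d - vd, d - wd)] with [d] the larger of [vd] and [wd], so
   one entry is 0, here and in the mixed cases. *)
- case=> h; rewrite h in hvd hwd.
    by apply: (@sec_gen _ _ _ 0 (3 * n)); rewrite ?hvd ?hwd; lia.
  by apply: (@sec_gen _ _ _ (3 * n) 0); rewrite ?hvd ?hwd ?orbT; lia.
- case=> h; rewrite h in hvd hwd.
    by apply: (@sec_gen _ _ _ 0 n); rewrite ?hvd ?hwd; lia.
  by apply: (@sec_gen _ _ _ n 0); rewrite ?hvd ?hwd ?orbT; lia.
- split=> h; [apply: repIso_two | apply: repIso_one]; by rewrite -hnpos.
Qed.
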